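(* Let $(R,\mathfrak m)$ be a Cohen-Macaulay local ring of dimension $d\geq2$ with infinite residue field, let $I_1,\ldots,I_s$ be $\mathfrak m$-primary ideals of $R$ and let $\mathcal F=\{\mathcal F(\underline n)\}_{\underline n\in\mathbb Z^s}$ be an $\underline I$-admissible filtration of ideals in $R$. Then the following statements are equivalent. (1) For all $\underline n\in\mathbb N^s$, $H^1_{\mathcal R_{++}}(\mathcal R(\mathcal F))_{\underline n}=0$. (2) For all $i=1,\ldots,s$, $\operatorname{grade}(G_i(\mathcal F)_{++})\geq1$.
   Context: Notation: $\mathbb N=\{0,1,2,\ldots\}$, $s\ge1$, $e=(1,\ldots,1)\in\mathbb Z^s$, $e_i$ is the $i$-th standard basis vector of $\mathbb Z^s$; $\underline n\ge\underline m$ means componentwise inequality; $\underline n^+=(\max(n_1,0),\ldots,\max(n_s,0))$; $\underline I=(I_1,\ldots,I_s)$ and $\underline I^{\underline n}=I_1^{n_1}\cdots I_s^{n_s}$, where a nonpositive power of an ideal is $R$. Filtrations: a $\mathbb Z^s$-graded $\underline I$-filtration is a family of ideals $\mathcal F=\{\mathcal F(\underline n)\}_{\underline n\in\mathbb Z^s}$ of $R$ with $\underline I^{\underline n}\subseteq\mathcal F(\underline n)$, $\mathcal F(\underline n)\mathcal F(\underline m)\subseteq\mathcal F(\underline n+\underline m)$, and $\mathcal F(\underline m)\subseteq\mathcal F(\underline n)$ whenever $\underline m\geq\underline n$. It is $\underline I$-admissible if moreover $\mathcal F(\underline n)=\mathcal F(\underline n^+)$ for all $\underline n$ and $\bigoplus_{\underline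 n\in\mathbb Z^s}\mathcal F(\underline n)\underline t^{\underline n}$ is a finite module over $\bigoplus_{\underline n\in\mathbb Z^s}\underline I^{\underline n}\underline t^{\underline n}$, where $t_1,\dots,t_s$ are indeterminates and $\underline t^{\underline n}=t_1^{n_1}\cdots t_s^{n_s}$. Rees rings: $\mathcal R(\mathcal F)=\bigoplus_{\underline n\in\mathbb N^s}\mathcal F(\underline n)\underline t^{\underline n}$, $\mathcal R(\underline I)=\bigoplus_{\underline n\in\mathbb N^s}\underline I^{\underline n}\underline t^{\underline n}$, and $\mathcal R_{++}=\bigoplus_{\underline n\ge e}\underline I^{\underline n}\underline t^{\underline n}$, an ideal of $\mathcal R(\underline I)$. $H^1_{\mathcal R_{++}}(\mathcal R(\mathcal F))$ is the first local cohomology of the $\mathcal R(\underline I)$-module $\mathcal R(\mathcal F)$ with support in $\mathcal R_{++}$; the subscript $\underline n$ denotes the degree $\underline n$ component. The associated multigraded ring of $\mathcal F$ with respect to $\mathcal F(e_i)$ is the $\mathbb N^s$-graded ring $G_i(\mathcal F)=\bigoplus_{\underline n\in\mathbb N^s}\mathcal F(\underline n)/\mathcal F(\underline n+e_i)$, and $G_i(\mathcal F)_{++}=\bigoplus_{\underline n\ge e}\mathcal F(\underline n)/\mathcal F(\underline n+e_i)$, an ideal of it. *)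

(* Defs.v *)
From HB Require Import structures.
From mathcomp Require Import all_boot all_order all_algebra.
From mathcomp Require Import generic_quotient ring_quotient.
From mathcomp Require Import boolp classical_sets cardinality fsbigop.
From mathcomp Require Import mpoly.

Set Implicit Arguments.
Unset Strict Implicit.
Unset Printing Implicit Defensive.

Import Order.TTheory GRing.Theory Num.Theory.

Local Open Scope ring_scope.
Local Open Scope classical_set_scope.

(* Ideals are propositional subsets of the ring and need not be proper, unlike
   those of [ring_quotient], since F(0) may be the whole ring. *)
Section CommutativeAlgebra.
Variable A : comPzRingType.
Implicit Types (I J P Q m : set A) (xs : seq A).

Definition is_ideal J :=
  [/\ J 0, forall x y, J x -> J y -> J (x + y) & forall a x, J x -> J (a * x)].

Definition ideal_gen (X : set A) : set A :=
  [set x | forall J, is_ideal J -> X `<=` J -> J x].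

Definition ideal_mul I J : set A :=
  ideal_gen [set z | exists x y, [/\ I x, J y & z = x * y]].

Definition ideal_pow I (k : nat) : set A := iter k (ideal_mul I) setT.

Definition prime_ideal P :=
  [/\ is_ideal P, ~ P 1 & forall x y, P (x * y) -> P x \/ P y].

Definition primary_ideal Q :=
  [/\ is_ideal Q, ~ Q 1 &
      forall x y, Q (x * y) -> Q x \/ exists k : nat, Q (y ^+ k)].

Definition maximal_ideal m :=
  [/\ is_ideal m, ~ m 1 &
      forall J, is_ideal J -> m `<=` J -> J = m \/ J = setT].

Definition radical I : set A := [set x | exists k : nat, I (x ^+ k)].

Definition noetherian :=
  forall J, is_ideal J -> exists xs, J = ideal_gen [set` xs].

Definition local_ring m :=
  maximal_ideal m /\ forall m', maximal_ideal m' -> m' = m.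

(* the set of cosets x + m is infinite *)
Definition infinite_residue_field m :=
  infinite_set (range (fun x : A => [set y | m (y - x)])).

Definition krull_dim_ge (d : nat) :=
  exists P : nat -> set A,
    (forall k, (k <= d)%N -> prime_ideal (P k)) /\
    (forall k, (k < d)%N -> P k `<` P k.+1).

Definition krull_dim_eq d := krull_dim_ge d /\ ~ krull_dim_ge d.+1.

Definition regular_sequence xs :=
  (forall k a, (k < size xs)%N ->
     ideal_gen [set` take k xs] (xs`_k * a) -> ideal_gen [set` take k xs] a)
  /\ ~ ideal_gen [set` xs] 1.

(* grade(J) is the supremum of the lengths of the regular sequences in J *)
Definition grade_ge J (k : nat) :=
  exists xs, [/\ regular_sequence xs, [set` xs] `<=` J & (k <= size xs)%N].

Definition grade_eq J k := grade_ge J k /\ ~ grade_ge J k.+1.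

Definition cohen_macaulay_local m d :=
  [/\ noetherian, local_ring m, krull_dim_eq d & grade_eq m d].

Definition m_primary m Q := primary_ideal Q /\ radical Q = m.

Lemma is_idealT : is_ideal setT. Proof. by []. Qed.

Lemma ideal_genP X : is_ideal (ideal_gen X).
Proof.
split=> [J [] //|x y hx hy J HJ sJ|a x hx J HJ sJ].
- by case: (HJ) => _ D _; apply: D; [apply: hx | apply: hy].
- by case: (HJ) => _ _ M; apply: M; apply: hx.
Qed.

Lemma ideal_mulP I J x y : I x -> J y -> ideal_mul I J (x * y).
Proof. by move=> Ix Jy K _; apply; exists x, y. Qed.

Lemma is_idealN J x : is_ideal J -> J x -> J (- x).
Proof. by case=> _ _ M Jx; rewrite -mulN1r; apply: M. Qed.

Lemma is_ideal_sum (K : Type) (r : seq K) (p : pred K) (f : K -> A) J :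
  is_ideal J -> (forall i, p i -> J (f i)) -> J (\sum_(i <- r | p i) f i).
Proof. by case=> J0 JD _ Jf; apply: big_ind. Qed.

Lemma ideal_powP I k : is_ideal (ideal_pow I k).
Proof. by case: k => [|k]; [apply: is_idealT | apply: ideal_genP]. Qed.

Lemma ideal_mul_colon I J K y : is_ideal K ->
  (forall u v, I u -> J v -> K (u * v * y)) ->
  forall x, ideal_mul I J x -> K (x * y).
Proof.
move=> [K0 KD KM] H x /(_ [set x | K (x * y)]); apply.
- split=> /= [|u v Ku Kv|a u Ku]; first by rewrite mul0r.
  + by rewrite mulrDl; apply: KD.
  + by rewrite -mulrA; apply: KM.
- by move=> _ [u [v [Iu Jv ->]]]; apply: H.
Qed.

Lemma ideal_powD I a b x y :
  ideal_pow I a x -> ideal_pow I b y -> ideal_pow I (a + b) (x * y).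
Proof.
elim: a x => [|a IHa] x; first by move=> _; case: (ideal_powP I b) => _ _; apply.
move=> Ix Iy; apply: ideal_mul_colon Ix; first exact: ideal_powP.
by move=> u v Iu Iv; rewrite -mulrA; apply: ideal_mulP => //; apply: IHa.
Qed.

Lemma ideal_pow_le I a b : (a <= b)%N -> ideal_pow I b `<=` ideal_pow I a.
Proof.
move=> /subnK <-; elim: (b - a)%N => [//|k IHk] x; apply.
  exact: ideal_powP.
move=> _ [u [v [_ Iv ->]]]; case: (ideal_powP I a) => _ _; apply.
exact: IHk.
Qed.

End CommutativeAlgebra.

(* The multidegrees Z^s. *)
Notation zvec s := {ffun 'I_s -> int}.

Definition zle s (m n : zvec s) := forall i, m i <= n i.
Definition zpos s (n : zvec s) : zvec s := [ffun i => Num.max (n i) 0].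
Definition zunit s (i : 'I_s) : zvec s := [ffun j => (j == i)%:Z].
Definition zdeg s (m : 'X_{1..s}) : zvec s := [ffun i => (m i)%:Z].

Lemma zdegD s (m n : 'X_{1..s}) : zdeg (m + n)%MM = zdeg m + zdeg n.
Proof. by apply/ffunP => i; rewrite !ffunE mnmDE PoszD. Qed.

Lemma zdeg0 s : zdeg (0%MM : 'X_{1..s}) = 0.
Proof. by apply/ffunP => i; rewrite !ffunE mnm0E. Qed.

Section Filtrations.
Variables (R : comNzRingType) (s : nat).
Implicit Types (I : 'I_s -> set R) (F : zvec s -> set R).

Definition ideal_zpow (J : set R) (k : int) : set R :=
  if k is Posz k then ideal_pow J k else setT.

Definition multi_pow I (n : zvec s) : set R :=
  \big[@ideal_mul R/setT]_(i < s) ideal_zpow (I i) (n i).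

Definition is_filtration I F :=
  [/\ forall n, is_ideal (F n),
      forall n, multi_pow I n `<=` F n,
      forall n m, ideal_mul (F n) (F m) `<=` F (n + m) &
      forall m n, zle n m -> F m `<=` F n].

Record filtration I := Filtration {
  filtration_fun :> zvec s -> set R;
  filtrationP : is_filtration I filtration_fun }.

(* Laurent polynomials in t_1, ..., t_s over R are the finitely supported
   functions Z^s -> R, under convolution *)
Definition laurent (f : zvec s -> R) := finite_set [set n | f n != 0].

Definition laurent_mul (f g : zvec s -> R) : zvec s -> R :=
  fun n => \sum_(m \in [set: zvec s]) f m * g (n - m).

(* the direct sum, over n in Z^s, of the F(n) t^n *)
Definition extended_rees F : set (zvec s -> R) :=
  [set f | laurent f /\ forall n, F n (f n)].

Definition extended_rees_finite I F :=
  exists (r : nat) (g : 'I_r -> zvec s -> R),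
    (forall j, extended_rees F (g j)) /\
    forall f, extended_rees F f ->
      exists a : 'I_r -> zvec s -> R,
        (forall j, extended_rees (multi_pow I) (a j)) /\
        forall n, f n = \sum_(j < r) laurent_mul (a j) (g j) n.

Definition admissible I (F : filtration I) :=
  (forall n, F n = F (zpos n)) /\ extended_rees_finite I F.

Lemma multi_powP I n : is_ideal (multi_pow I n).
Proof.
rewrite /multi_pow; elim/big_rec: _ => [|i X _ _]; first exact: is_idealT.
exact: ideal_genP.
Qed.

Lemma ideal_zpowP (J : set R) k : is_ideal (ideal_zpow J k).
Proof. by case: k => k; [apply: ideal_powP | apply: is_idealT]. Qed.

Lemma ideal_zpow_le (J : set R) k l :
  k <= l -> ideal_zpow J l `<=` ideal_zpow J k.
Proof. by case: k l => k [] l //=; apply: ideal_pow_le. Qed.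

Lemma ideal_zpowD (J : set R) k l x y :
  ideal_zpow J k x -> ideal_zpow J l y -> ideal_zpow J (k + l) (x * y).
Proof.
case: k l => k [] l Jx Jy.
- exact: ideal_powD.
- apply: (@ideal_zpow_le _ _ (Posz k)); first by rewrite gerDl.
  by rewrite mulrC; case: (ideal_zpowP J (Posz k)) => _ _; apply.
- apply: (@ideal_zpow_le _ _ (Posz l)); first by rewrite gerDr.
  by case: (ideal_zpowP J (Posz l)) => _ _; apply.
- by [].
Qed.

Lemma multi_powD I n m x y :
  multi_pow I n x -> multi_pow I m y -> multi_pow I (n + m) (x * y).
Proof.
move=> Ix Iy; pose K (X Y Z : set R) :=
  is_ideal Z /\ forall x y, X x -> Y y -> Z (x * y).
suff [_] : K (multi_pow I n) (multi_pow I m) (multi_pow I (n + m)) by apply.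
rewrite /multi_pow; elim: (index_enum _) => [|i l [IH1 IH2]].
  by rewrite !big_nil; split.
rewrite !big_cons ffunE; split=> [|u v Iu Iv]; first exact: ideal_genP.
apply: ideal_mul_colon Iu; first exact: ideal_genP.
move=> u1 u2 Iu1 Iu2; rewrite mulrC.
apply: ideal_mul_colon Iv; first exact: ideal_genP.
move=> v1 v2 Iv1 Iv2; rewrite mulrACA [v1 * _]mulrC [v2 * _]mulrC.
by apply: ideal_mulP; [apply: ideal_zpowD | apply: IH2].
Qed.

Lemma multi_pow_filtration I : is_filtration I (multi_pow I).
Proof.
split; [exact: multi_powP | by move=> n x | move=> n m x | move=> m n le_nm x Ix].
- apply=> [|_ [u [v [Iu Iv ->]]]]; first exact: multi_powP.
  exact: multi_powD.
- have -> : n = m + (n - m) by rewrite addrC subrK.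
  rewrite -[x]mulr1; apply: multi_powD => //.
  have {Ix}: forall i, (n - m) i <= 0 by move=> i; rewrite !ffunE subr_le0 le_nm.
  rewrite /multi_pow => le0; elim: (index_enum _) => [|i l IHl].
    by rewrite big_nil.
  rewrite big_cons -[1]mulr1; apply: ideal_mulP => //.
  exact: ideal_zpow_le (le0 i) _ _.
Qed.

Definition adic_filtration I := Filtration (multi_pow_filtration I).

End Filtrations.

(* The Rees ring of F is a subring of R[t_1, ..., t_s] = {mpoly R[s]}. *)
Section ReesRing.
Variables (R : comNzRingType) (s : nat) (I : 'I_s -> set R).
Variable F : filtration I.

Definition rees_pred : {pred {mpoly R[s]}} :=
  fun p => `[< forall m : 'X_{1..s}, F (zdeg m) p@_m >].

Lemma rees_predP p :
  reflect (forall m, F (zdeg m) p@_m) (p \in rees_pred).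
Proof. exact: asboolP. Qed.

Fact rees_subring_closed : subring_closed rees_pred.
Proof.
case: (filtrationP F) => Fid FI FM _; split.
- apply/rees_predP => m; rewrite mcoeff1; case: eqP => [->|_].
    rewrite zdeg0; apply: FI; rewrite /multi_pow.
    elim: (index_enum _) => [|i l IHl]; first by rewrite big_nil.
    by rewrite big_cons ffunE -[1]mulr1; apply: ideal_mulP.
  by case: (Fid (zdeg m)).
- move=> p q /rees_predP Fp /rees_predP Fq; apply/rees_predP => m.
  have FidM := Fid (zdeg m); case: (FidM) => _ FD _.
  by rewrite mcoeffB; apply: FD => //; apply: is_idealN.
- move=> p q /rees_predP Fp /rees_predP Fq; apply/rees_predP => m.
  rewrite mcoeffM; apply: is_ideal_sum => // -[k l] /= /eqP m_kl.
  by rewrite {1}m_kl zdegD; apply: FM; apply: ideal_mulP.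
Qed.

HB.instance Definition _ :=
  GRing.isSubringClosed.Build _ rees_pred rees_subring_closed.

Record rees := Rees { rees_val :> {mpoly R[s]}; _ : rees_val \in rees_pred }.

HB.instance Definition _ := [isSub for rees_val].
HB.instance Definition _ := [Choice of rees by <:].
HB.instance Definition _ := [SubChoice_isSubComNzRing of rees by <:].

Lemma reesP (p : rees) m : F (zdeg m) (rees_val p)@_m.
Proof. by case: p => p /= /rees_predP. Qed.

(* degree-n component; it is 0 when n is not in N^s *)
Definition rees_homog (n : zvec s) : set rees :=
  [set p | forall m, (rees_val p)@_m != 0 -> zdeg m = n].

Definition rees_pp : set rees :=
  [set p | forall m, (rees_val p)@_m != 0 -> forall i, (0 < m i)%N].

End ReesRing.

Arguments rees_homog {R s I} F n.
Arguments rees_pp {R s I} F.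

(* The Rees ring of F as a module over the Rees ring of I. *)
Section ReesModule.
Variables (R : comNzRingType) (s : nat) (I : 'I_s -> set R).
Variable F : filtration I.
Local Notation A := (rees (adic_filtration I)).

Fact rees_scale_subproof (a : A) (p : rees F) :
  rees_val a * rees_val p \in rees_pred F.
Proof.
case: (filtrationP F) => Fid FI FM _; apply/rees_predP => m.
rewrite mcoeffM; apply: is_ideal_sum => // -[k l] /= /eqP m_kl.
rewrite {1}m_kl zdegD; apply: FM; apply: ideal_mulP; last exact: reesP.
by apply: FI; apply: (reesP a).
Qed.

Definition rees_scale a p : rees F := Rees (rees_scale_subproof a p).

Fact rees_scaleA a b p : rees_scale a (rees_scale b p) = rees_scale (a * b) p.
Proof. by apply: val_inj; rewrite /= mulrA. Qed.
Fact rees_scale1 : left_id 1 rees_scale.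
Proof. by move=> p; apply: val_inj; rewrite /= mul1r. Qed.
Fact rees_scaleDr : right_distributive rees_scale +%R.
Proof. by move=> a p q; apply: val_inj; rewrite /= mulrDr. Qed.
Fact rees_scaleDl p : {morph rees_scale^~ p : a b / a + b}.
Proof. by move=> a b; apply: val_inj; rewrite /= mulrDl. Qed.

HB.instance Definition _ := GRing.Zmodule_isLmodule.Build A (rees F)
  rees_scaleA rees_scale1 rees_scaleDr rees_scaleDl.

End ReesModule.

(* G_i(F) is the quotient of the Rees ring of F by the ideal
   (+)_(n in N^s) F(n + e_i) t^n. *)
Section AssociatedGraded.
Variables (R : comNzRingType) (s : nat) (I : 'I_s -> set R).
Variables (F : filtration I) (i : 'I_s).

Definition shift_pred : {pred rees F} :=
  fun p => `[< forall m, F (zdeg m + zunit i) (rees_val p)@_m >].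

Lemma shift_predP (p : rees F) :
  reflect (forall m, F (zdeg m + zunit i) (rees_val p)@_m) (p \in shift_pred).
Proof. exact: asboolP. Qed.

Fact shift_zmod_closed : zmod_closed shift_pred.
Proof.
case: (filtrationP F) => Fid _ _ _; split.
  by apply/shift_predP => m; rewrite mcoeff0; case: (Fid (zdeg m + zunit i)).
move=> p q /shift_predP Fp /shift_predP Fq; apply/shift_predP => m.
have FidM := Fid (zdeg m + zunit i); case: (FidM) => _ FD _.
by rewrite mcoeffB; apply: FD => //; apply: is_idealN.
Qed.

HB.instance Definition _ :=
  GRing.isZmodClosed.Build _ shift_pred shift_zmod_closed.

Lemma shift_mul (p q : rees F) : q \in shift_pred -> p * q \in shift_pred.
Proof.
case: (filtrationP F) => Fid _ FM _ /shift_predP Fq; apply/shift_predP => m.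
rewrite mcoeffM; apply: is_ideal_sum => // -[k l] /= /eqP m_kl.
by rewrite {1}m_kl zdegD -addrA; apply: FM; apply: ideal_mulP => //; apply: reesP.
Qed.

Definition assoc_ring := {ideal_quot shift_pred}.

HB.instance Definition _ := GRing.Zmodule.on assoc_ring.

Definition assoc_pi (p : rees F) : assoc_ring :=
  (\pi_{ideal_quot shift_pred} p)%qT.

Definition assoc_mul (x y : assoc_ring) : assoc_ring :=
  assoc_pi (repr (x : {ideal_quot shift_pred}) * repr (y : {ideal_quot shift_pred})).

Lemma assoc_piP (p q : rees F) :
  reflect (assoc_pi p = assoc_pi q) (p - q \in shift_pred).
Proof. by rewrite (Quotient.idealrBE shift_pred); apply: eqP. Qed.

Lemma assoc_reprK (x : assoc_ring) :
  assoc_pi (repr (x : {ideal_quot shift_pred})) = x.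
Proof. exact: reprK. Qed.

Lemma assoc_piD : {morph assoc_pi : p q / p + q}.
Proof. exact: (Quotient.pi_add shift_pred). Qed.

Lemma assoc_piM p q : assoc_mul (assoc_pi p) (assoc_pi q) = assoc_pi (p * q).
Proof.
rewrite /assoc_mul; set p' := repr _; set q' := repr _; apply/assoc_piP.
have -> : p' * q' - p * q = q' * (p' - p) + p * (q' - q).
  by rewrite !mulrBr [q' * p']mulrC [q' * p]mulrC addrA subrK.
by rewrite rpredD //; apply: shift_mul; apply/assoc_piP; rewrite assoc_reprK.
Qed.

Fact assoc_mulA : associative assoc_mul.
Proof.
move=> x y z; rewrite -[x]assoc_reprK -[y]assoc_reprK -[z]assoc_reprK.
by rewrite !assoc_piM mulrA.
Qed.
Fact assoc_mulC : commutative assoc_mul.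
Proof. by move=> x y; rewrite /assoc_mul mulrC. Qed.
Fact assoc_mul1 : left_id (assoc_pi 1) assoc_mul.
Proof. by move=> x; rewrite -[x]assoc_reprK assoc_piM mul1r. Qed.
Fact assoc_mulDl : left_distributive assoc_mul +%R.
Proof.
move=> x y z; rewrite -[x]assoc_reprK -[y]assoc_reprK -[z]assoc_reprK.
by rewrite -assoc_piD !assoc_piM mulrDl assoc_piD.
Qed.

HB.instance Definition _ := GRing.Zmodule_isComPzRing.Build assoc_ring
  assoc_mulA assoc_mulC assoc_mul1 assoc_mulDl.

(* G_i(F)_++ *)
Definition assoc_pp : set assoc_ring := assoc_pi @` rees_pp F.

End AssociatedGraded.

Arguments assoc_pp {R s I} F i.

(* Cech complex  M -> prod_i M_(x_i) -> prod_(i < j) M_(x_i x_j)  of a family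
   x of elements of A.  A pair (u, k) stands for the fraction u / x^k. *)
Section CechComplex.
Variables (A : comPzRingType) (M : lmodType A).

Definition frac_eq (x : A) (u v : M * nat) :=
  exists l : nat, x ^+ l *: (x ^+ v.2 *: u.1 - x ^+ u.2 *: v.1) = 0.

(* u / x^k = y^k u / (x y)^k *)
Definition frac_map (y : A) (u : M * nat) : M * nat := (y ^+ u.2 *: u.1, u.2).

Variables (r : nat) (x : 'I_r -> A).

Definition cech_cocycle (c : 'I_r -> M * nat) := forall i j : 'I_r, (i < j)%N ->
  frac_eq (x i * x j) (frac_map (x j) (c i)) (frac_map (x i) (c j)).

Definition cech_boundary (u : M) (c : 'I_r -> M * nat) :=
  forall i, frac_eq (x i) (u, 0%N) (c i).

(* When x i is homogeneous of degree d i, the degree-n component of M_(x_i)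
   consists of the u / x_i^k with u homogeneous of degree n + k d_i. *)
Definition cech_H1_eq0 (D : zmodType) (M_ : D -> set M) (d : 'I_r -> D) (n : D) :=
  forall c : 'I_r -> M * nat,
    (forall i, M_ (n + d i *+ (c i).2) (c i).1) -> cech_cocycle c ->
    exists2 u, M_ n u & cech_boundary u c.

End CechComplex.

(* Vanishing in degree n of the first local cohomology of M with support in the
   homogeneous ideal J, for the gradings A_ of A and M_ of M, computed by the
   Cech complex of a finite system of homogeneous generators of J; up to
   isomorphism this does not depend on the system. *)
Definition local_cohomology1_eq0 (A : comPzRingType) (M : lmodType A)
    (D : zmodType) (A_ : D -> set A) (M_ : D -> set M) (J : set A) (n : D) :=
  exists (r : nat) (x : 'I_r -> A) (d : 'I_r -> D),
    [/\ forall i, A_ (d i) (x i), J = ideal_gen (range x) &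
        cech_H1_eq0 x M_ d n].

(* H^1_{R_++}(R(F))_n = 0 *)
Definition H1_rees_eq0 (R : comNzRingType) (s : nat) (I : 'I_s -> set R)
    (F : filtration I) (n : zvec s) :=
  @local_cohomology1_eq0 (rees (adic_filtration I)) (rees F) (zvec s)
    (rees_homog (adic_filtration I)) (rees_homog F)
    (rees_pp (adic_filtration I)) n.

(* Main.v *)
Require Import Defs.
From HB Require Import structures.
From mathcomp Require Import all_boot all_order all_algebra.
From mathcomp Require Import boolp classical_sets.
From mathcomp Require Import mpoly ring zify.

Set Implicit Arguments.
Unset Strict Implicit.
Unset Printing Implicit Defensive.

Import Order.TTheory GRing.Theory Num.Theory.

(** Both statements are equivalent to a third one: for every n in N^s, an
    element b of R lies in F(n) as soon as I^(ke) b is contained in F(n + ke)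
    for some k ([saturated]); in other words, F coincides with its Ratliff-Rush
    closure in nonnegative degrees.

    Cohomology.  Let x_i = a_i t^(d_i) generate R_++.  A degree-n cocycle is a
    compatible family of fractions v_i / a_i^(k_i).  Since the ideal generated
    by the a_i is primary to the maximal ideal and R has depth at least 2, such
    a family comes from a single b in R ([depth2_glue]), with a_i^K b in
    F(n + K d_i) for large K; depth 1 makes b unique.  Conversely every b such
    that I^(ke) b is contained in F(n + ke) yields the cocycle x_i^k b t^n / x_i^k,
    and it is a coboundary exactly when b is in F(n).  So the vanishing in degree
    n is saturation in degree n ([H1_saturated], [saturated_H1]).  The passage
    between Rees rings and R is the evaluation at t = 1 ([ev]), which is
    injective on each graded piece ([rees_homogE]).

    From grade to saturation.  If I^(ke) b is contained in F(n + ke), climb from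
    degree 0 to degree n one unit vector at a time.  When b lies in F(p) and
    p + e_i <= n, the class of b t^p in G_i(F) is killed by a high power of any
    element of G_i(F)_++, because F(q) = I^(ke) F(q - ke) for large q by
    finiteness; a nonzerodivisor in G_i(F)_++ then puts b in F(p + e_i)
    ([grade_step], [grade_saturated]).

    From saturation to grade.  The Rees ring of F is an R-algebra of finite type,
    hence Noetherian by the Hilbert basis theorem, and so is its quotient G_i(F).
    In a Noetherian ring an ideal made of zero divisors is killed by a single
    nonzero element ([noetherian_nzd]).  If z <> 0 killed G_i(F)_++, then each
    homogeneous component b of a lift of z, of degree n, would satisfy
    I^e b contained in F(n + e_i + e), so it would lie in F(n + e_i) by
    saturation, and z would be 0 ([saturated_grade]).  The ideal G_i(F)_++ is
    proper because finiteness over the powers of I forbids F(e_i) = R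
    ([fil_unit_proper]). *)

(** * Noetherian rings and their zero divisors *)

Section Noetherian.
Local Open Scope ring_scope.
Local Open Scope classical_set_scope.
Variable A : comPzRingType.
Implicit Types (J : set A) (x y z : A) (zs : seq A).

Lemma ideal_gen_sub (X : set A) J : is_ideal J -> X `<=` J -> ideal_gen X `<=` J.
Proof. by move=> HJ XJ x; apply. Qed.

Lemma sub_ideal_gen (X : set A) : X `<=` ideal_gen X.
Proof. by move=> x Xx J _; apply. Qed.

Lemma noetherian_acc (H : nat -> set A) :
  noetherian A -> (forall n, is_ideal (H n)) -> (forall n, H n `<=` H n.+1) ->
  exists N, forall n, H n `<=` H N.
Proof.
move=> noethA Hid Hinc.
have mono p q : (p <= q)%N -> H p `<=` H q.
  by move=> /subnK <-; elim: (q - p)%N => [//|k IHk] x /IHk; apply: Hinc.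
have [|xs Uxs] := noethA (\bigcup_n H n).
  split; first by exists 0%N => //; case: (Hid 0%N).
  - move=> x y [p _ Hx] [q _ Hy]; exists (maxn p q) => //.
    by case: (Hid (maxn p q)) => _ + _; apply;
      [apply: mono Hx; apply: leq_maxl | apply: mono Hy; apply: leq_maxr].
  - by move=> a x [p _ Hx]; exists p => //; case: (Hid p) => _ _; apply.
have : [set` xs] `<=` \bigcup_n H n by rewrite Uxs; apply: sub_ideal_gen.
have [N HN] : exists N, [set` xs] `<=` \bigcup_n H n -> [set` xs] `<=` H N.
  elim: {Uxs} xs => [|x xs [N IH]]; first by exists 0%N.
  have [[p _ Hp]|nUx] := pselect ((\bigcup_n H n) x); last first.
    by exists 0%N => sU; case: nUx; apply: sU; rewrite /= mem_head.
  exists (maxn p N) => sU y /=; rewrite inE => /predU1P[->|yxs].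
    by apply: mono Hp; apply: leq_maxl.
  apply: mono (leq_maxr _ _) _ _; apply: IH => // z zxs; apply: sU.
  by rewrite /= inE zxs orbT.
move=> /HN xsN; exists N => n x Hx.
apply: (ideal_gen_sub (Hid N) xsN); rewrite -Uxs; by exists n.
Qed.

(** Otherwise a choice of larger members would give a strictly increasing
    sequence of ideals above J. *)
Lemma noetherian_max (P : set (set A)) J :
  noetherian A -> P `<=` @is_ideal A -> P J ->
  exists2 K, P K & J `<=` K /\ forall K', P K' -> K `<=` K' -> K' `<=` K.
Proof.
move=> noethA Pid PJ; apply: contrapT => nomax.
have step K : exists K', P K /\ J `<=` K -> [/\ P K', K `<=` K' & ~ K' `<=` K].
  have [[PK JK]|nK] := pselect (P K /\ J `<=` K); last by exists K.
  apply: contrapT => nK; apply: nomax; exists K => //; split=> // K' PK' KK'.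
  by apply: contrapT => K'K; apply: nK; exists K'.
have [next nextP] := choice step.
pose H n := iter n next J.
have HP n : P (H n) /\ J `<=` H n.
  elim: n => [|n IHn]; first by split.
  case: (nextP _ IHn) => P1 S1 _; split=> //.
  by move=> x Jx; apply: S1; apply: IHn.2.
have [||N HN] := noetherian_acc (H := H) noethA.
- by move=> n; apply: Pid; case: (HP n).
- by move=> n; case: (nextP _ (HP n)).
by case: (nextP _ (HP N)) => _ _; apply; apply: (HN N.+1).
Qed.

Lemma colon_ideal J z : is_ideal J -> is_ideal [set x | J (x * z)].
Proof.
case=> J0 JD JM; split=> /= [|x y Jx Jy|a x Jx]; first by rewrite mul0r.
  by rewrite mulrDl; apply: JD.
by rewrite -mulrA; apply: JM.
Qed.

Definition ann z : set A := [set x | x * z = 0].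

Lemma ann_ideal z : is_ideal (ann z).
Proof.
apply: (colon_ideal (J := [set 0])); split=> //= [x y -> ->|a x ->].
  by rewrite addr0.
by rewrite mulr0.
Qed.

Lemma nzd_exp x : (forall z, x * z = 0 -> z = 0) ->
  forall N z, x ^+ N * z = 0 -> z = 0.
Proof.
move=> xr; elim=> [|N IH] z; first by rewrite mul1r.
by rewrite exprS -mulrA => /xr; apply: IH.
Qed.

(** The annihilators of such z are the maximal associated primes. *)
Definition max_ann z :=
  z != 0 /\ forall w, w != 0 -> ann z `<=` ann w -> ann w `<=` ann z.

Lemma ex_max_ann z : noetherian A -> z != 0 ->
  exists2 w, max_ann w & ann z `<=` ann w.
Proof.
move=> noethA z0.
have [||_ [w w0 <-] [zw wmax]] :=
    @noetherian_max (ann @` [set w | w != 0]) (ann z) noethA.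
- by move=> _ [w _ <-]; apply: ann_ideal.
- by exists z.
exists w => //; split=> // w' w'0; apply: wmax; by exists w'.
Qed.

(** The classical primality of a maximal annihilator: ann z is contained in
    ann (y z), so the two are equal when y z is nonzero. *)
Lemma max_ann_prime z x y :
  max_ann z -> y * z != 0 -> x * (y * z) = 0 -> x * z = 0.
Proof.
move=> [_ zmax] yz0 xyz; apply: (zmax _ yz0) => // w /= wz.
by rewrite /ann /= mulrCA wz mulr0.
Qed.

(** Multiply one element of each ann w outside ann z; primality keeps the
    product outside ann z. *)
Lemma max_ann_separate z zs : max_ann z ->
  (forall w, w \in zs -> ~ ann w `<=` ann z) ->
  exists2 x, x * z != 0 & forall w, w \in zs -> x * w = 0.
Proof.
move=> mz; elim: zs => [_|w zs IH nsub].
  by exists 1 => //; rewrite mul1r; case: mz.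
have [v vzs|x xz xzs] := IH; first by apply: nsub; rewrite inE vzs orbT.
have /existsNP[y /not_implyP[yw yz]] := nsub w (mem_head _ _).
exists (x * y) => [|v].
  apply: contra_notN yz => /eqP.
  by rewrite mulrAC mulrC; apply: max_ann_prime.
rewrite inE => /predU1P[->|/xzs xv]; first by rewrite -mulrA yw mulr0.
by rewrite mulrAC xv mul0r.
Qed.

(** Choose zs so that the ideal it generates is maximal among the ideals
    generated by finitely many such elements.  Every z with maximal annihilator
    then lies in that ideal, and were no ann w inside ann z, the separating
    element would kill all of zs but not z. *)
Lemma max_ann_finite : noetherian A ->
  exists2 zs : seq A, forall z, z \in zs -> max_ann z
  & forall z, max_ann z -> exists2 w, w \in zs & ann w = ann z.
Proof.
move=> noethA.
have [||_ [zs mzs <-] [_ zsmax]] := @noetherian_max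
    ((fun zs : seq A => ideal_gen [set` zs]) @`
      [set zs : seq A | forall z, z \in zs -> max_ann z])
    (ideal_gen [set` [::] : seq A]) noethA.
- by move=> _ [zs _ <-]; apply: ideal_genP.
- by exists [::].
exists zs => // z mz; apply: contrapT => nz.
have zzs : ideal_gen [set` zs] z.
  apply: (zsmax (ideal_gen [set` z :: zs])).
  - exists (z :: zs) => // w /=; rewrite inE => /predU1P[->//|]; exact: mzs.
  - apply: ideal_gen_sub; first exact: ideal_genP.
    by move=> w wzs; apply: sub_ideal_gen; rewrite /= inE [w \in zs]wzs orbT.
  - by apply: sub_ideal_gen; rewrite /= mem_head.
have [w wzs|x /eqP xz xzs] := @max_ann_separate z zs mz.
  move=> sub; apply: nz; exists w => //; rewrite eqEsubset; split=> //.
  by case: (mzs w wzs) => _; apply=> //; case: mz.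
apply: xz; rewrite mulrC; apply: (ideal_gen_sub (ann_ideal x) _ zzs) => w /= wzs.
by rewrite /ann /= mulrC xzs.
Qed.

(** Prime avoidance, one prime at a time: if the x found so far lies in ann z,
    then every earlier ann w fails to be contained in ann z, so a multiple v * y
    with y in J can be added that changes x modulo ann z only. *)
Lemma max_ann_avoid J zs : is_ideal J ->
  (forall z, z != 0 -> exists2 x, J x & x * z != 0) ->
  (forall z, z \in zs -> max_ann z) ->
  exists2 x, J x & forall z, z \in zs -> x * z != 0.
Proof.
move=> HJ Jz; case: (HJ) => J0 JD JM; elim: zs => [|z zs IH] mzs.
  by exists 0.
have mz := mzs z (mem_head _ _).
have [w wzs|x Jx xzs] := IH; first by apply: mzs; rewrite inE wzs orbT.
have [xz|xz] := eqVneq (x * z) 0; last first.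
  by exists x => // w; rewrite inE => /predU1P[->//|]; apply: xzs.
have [w wzs|v vz vzs] := @max_ann_separate z zs mz.
  move=> wz; have [_ wmax] : max_ann w by apply: mzs; rewrite inE wzs orbT.
  by move/eqP: (xzs w wzs); apply; apply: (wmax z) => //; case: mz.
have [y Jy yz] := Jz z (proj1 mz).
exists (x + v * y) => [|w]; first by apply: JD => //; apply: JM.
rewrite inE => /predU1P[->|wzs].
  rewrite mulrDl xz add0r -mulrA; apply: contra_neq vz; exact: max_ann_prime.
by rewrite mulrDl mulrAC (vzs w wzs) mul0r addr0 xzs.
Qed.

(** Every zero divisor lies in one of finitely many maximal annihilators, which
    the ideal J can avoid simultaneously. *)
Lemma noetherian_nzd J : noetherian A -> is_ideal J ->
  (forall z, z != 0 -> exists2 x, J x & x * z != 0) ->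
  exists2 x, J x & forall z, x * z = 0 -> z = 0.
Proof.
move=> noethA HJ Jz; have [zs mzs zsmax] := max_ann_finite noethA.
have [x Jx xzs] := max_ann_avoid HJ Jz mzs.
exists x => // z xz; apply/eqP; apply: contrapT => /negP z0.
have [w mw zw] := ex_max_ann noethA z0.
have [v vzs vw] := zsmax w mw.
by move/eqP: (xzs v vzs); apply; have: ann w x by [apply: zw]; rewrite -vw.
Qed.

Lemma ideal_gen0 x : ideal_gen [set` [::]] x -> x = 0.
Proof.
apply: (ideal_gen_sub (J := [set 0])) => //; split=> //= [|a y ->].
  by move=> y z -> ->; rewrite addr0.
by rewrite mulr0.
Qed.

Lemma grade_ge1P J :
  grade_ge J 1 -> exists2 x, J x & forall z, x * z = 0 -> z = 0.
Proof.
move=> [[|x xs] [[reg _] xsJ] //= _].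
exists x => [|z xz]; first by apply: xsJ; rewrite /= mem_head.
apply: ideal_gen0; apply: (reg 0%N z) => //=; rewrite xz.
by case: (ideal_genP [set` [::] : seq A]).
Qed.

Lemma radical_mul (P Q : set A) x :
  radical P x -> radical Q x -> radical (ideal_mul P Q) x.
Proof.
by move=> [k Px] [l Qx]; exists (k + l)%N; rewrite exprD; apply: ideal_mulP.
Qed.

End Noetherian.

(** * Algebras of finite type over a Noetherian ring *)

Section FiniteType.
Local Open Scope ring_scope.
Local Open Scope classical_set_scope.

Lemma noetherian_surj (A B : comPzRingType) (f : A -> B) :
  f 0 = 0 -> {morph f : x y / x + y} -> {morph f : x y / x * y} ->
  (forall b, exists a, f a = b) -> noetherian A -> noetherian B.
Proof.
move=> f0 fD fM fsurj noethA J [J0 JD JM].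
have [|xs Exs] := noethA (f @^-1` J).
  split=> /= [|x y Jx Jy|a x Jx]; first by rewrite f0.
    by rewrite fD; apply: JD.
  by rewrite fM; apply: JM.
exists (map f xs); rewrite eqEsubset; split=> [b Jb|]; last first.
  apply: ideal_gen_sub => // _ /mapP[x xxs ->].
  by have : (f @^-1` J) x by rewrite Exs; apply: sub_ideal_gen.
have [a ab] := fsurj b; rewrite -ab in Jb *.
have : ideal_gen [set` xs] a by rewrite -Exs.
apply: (@ideal_gen_sub _ _ (f @^-1` ideal_gen [set` map f xs])).
  have [K0 KD KM] := ideal_genP [set` map f xs].
  split=> /= [|x y Jx Jy|c x Jx]; first by rewrite f0.
    by rewrite fD; apply: KD.
  by rewrite fM; apply: KM.
by move=> x xxs; apply: sub_ideal_gen; apply: map_f.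
Qed.

Variable R : comNzRingType.

(** The leading coefficients in degree n; the bound on the size allows 0 as a
    coefficient, which makes this an ideal. *)
Definition lead_ideal (J : set {poly R}) (n : nat) : set R :=
  [set c | exists p : {poly R}, [/\ J p, (size p <= n.+1)%N & p`_n = c]].

Lemma lead_idealP J n : is_ideal J -> is_ideal (lead_ideal J n).
Proof.
case=> J0 JD JM; split.
- by exists 0; rewrite size_poly0 coef0.
- move=> _ _ [p [Jp sp <-]] [q [Jq sq <-]]; exists (p + q); rewrite coefD.
  by split=> //; [apply: JD | rewrite (leq_trans (size_polyD _ _)) // geq_max sp].
- move=> a _ [p [Jp sp <-]]; exists (a%:P * p); rewrite coefCM; split=> //.
    exact: JM.
  by rewrite mul_polyC (leq_trans (size_scale_leq _ _)).
Qed.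

Lemma lead_idealS J n : is_ideal J -> lead_ideal J n `<=` lead_ideal J n.+1.
Proof.
case=> _ _ JM _ [p [Jp sp <-]]; exists ('X * p); rewrite coefXM.
split=> //; first exact: JM.
have [->|p0] := eqVneq p 0; first by rewrite mulr0 size_poly0.
by rewrite mulrC size_mulX.
Qed.

(** The ideals of leading coefficients are stationary from some degree N on.
    Finitely many polynomials of J realise generators of those of degree at most
    N, and division by them lowers the size of any element of J. *)
Theorem hilbert_basis : noetherian R -> noetherian {poly R}.
Proof.
move=> noethR J HJ; case: (HJ) => J0 JD JM.
have Lid n : is_ideal (lead_ideal J n) by exact: lead_idealP.
have [n|N LN] := noetherian_acc noethR Lid; first exact: lead_idealS.
(* Polynomials of J whose degree-n coefficients generate the ideal. *)
have gens n : exists qs : seq {poly R}, [set` qs] `<=` J /\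
    lead_ideal J n `<=` lead_ideal (ideal_gen [set` qs]) n.
  have [cs Ecs] := noethR _ (Lid n).
  have : [set` cs] `<=` lead_ideal J n by rewrite Ecs; apply: sub_ideal_gen.
  suff [qs [qsJ csqs]] : exists qs : seq {poly R}, [set` qs] `<=` J /\
    ([set` cs] `<=` lead_ideal J n ->
     [set` cs] `<=` lead_ideal (ideal_gen [set` qs]) n).
    move=> /csqs sub; exists qs; split=> //; rewrite Ecs.
    by apply: ideal_gen_sub sub; apply/lead_idealP/ideal_genP.
  elim: cs {Ecs} => [|c cs [qs [qsJ IH]]]; first by exists [::].
  have [[p [Jp sp pc]]|nc] := pselect (lead_ideal J n c); last first.
    by exists [::]; split=> // sub; case: nc; apply: sub; rewrite /= mem_head.
  exists (p :: qs); split=> [q /=|sub d /=].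
    by rewrite inE => /predU1P[->//|]; apply: qsJ.
  rewrite inE => /predU1P[->|dcs].
    by exists p; split=> //; apply: sub_ideal_gen; rewrite /= mem_head.
  have [|q [Gq sq qd]] := IH _ d dcs.
    by move=> e ecs; apply: sub; rewrite /= inE [e \in cs]ecs orbT.
  exists q; split=> //; apply: ideal_gen_sub Gq; first exact: ideal_genP.
  by move=> r rqs; apply: sub_ideal_gen; rewrite /= inE [r \in qs]rqs orbT.
have [qs qsP] := choice gens.
pose G := flatten [seq qs n | n <- iota 0 N.+1].
have qsG n : (n <= N)%N -> [set` qs n] `<=` ideal_gen [set` G].
  move=> nN q qn; apply: sub_ideal_gen; apply/flatten_mapP; exists n => //.
  by rewrite mem_iota add0n ltnS.
exists G; rewrite eqEsubset; split=> [p|]; last first.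
  by apply: ideal_gen_sub => // q /flatten_mapP[n _ /(proj1 (qsP n))].
have [G0 GD GM] := ideal_genP [set` G].
move: {2}(size p) (leqnn (size p)) => n; elim: n p => [|n IHn] p.
  by rewrite leqn0 size_poly_eq0 => /eqP -> _; apply: G0.
move=> sp Jp.
have [q [Gq sq qp]] : lead_ideal (ideal_gen [set` G]) n p`_n.
  have Lp : lead_ideal J n p`_n by exists p.
  have [nN|/ltnW Nn] := leqP n N.
    have [q [Gq sq qp]] := proj2 (qsP n) _ Lp; exists q; split=> //.
    by apply: ideal_gen_sub Gq; [apply: ideal_genP | apply: qsG].
  (* Above degree N, a polynomial of degree N is multiplied by a power of 'X. *)
  have {}Lp : lead_ideal (ideal_gen [set` G]) N p`_n.
    have [q [Gq sq qp]] := proj2 (qsP N) _ (LN n _ Lp); exists q; split=> //.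
    by apply: ideal_gen_sub Gq; [apply: ideal_genP | apply: qsG].
  move: Lp; rewrite -{2}(subnK Nn); elim: (n - N)%N => [//|k IHk] /IHk.
  by rewrite addSn; apply: lead_idealS; apply: ideal_genP.
rewrite -[p](subrK q); apply: GD => //; apply: IHn.
  apply/leq_sizeP => j; rewrite leq_eqVlt => /predU1P[<-|nj].
    by rewrite coefB qp subrr.
  have pj : (size (p - q)%R <= j)%N.
    by apply: leq_trans nj; rewrite (leq_trans (size_polyD _ _)) // size_polyN geq_max sp.
  by rewrite nth_default.
apply: JD => //; apply: is_idealN => //.
apply: (@ideal_gen_sub _ [set` G] J) => // r /flatten_mapP[k _].
exact: (proj1 (qsP k)).
Qed.

End FiniteType.

(** The closure condition says that B is generated as a ring by the image of R
    and by xs.  Adjoining the generators one by one, with {poly R} as the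
    next base ring, reduces to polynomials in one variable. *)
Theorem noetherian_finite_type (R B : comNzRingType) (h : {rmorphism R -> B})
    (xs : seq B) :
  noetherian R ->
  (forall P : set B, (forall r, P (h r)) -> [set` xs]%classic `<=` P ->
     (forall x y, P x -> P y -> P (x + y)%R) ->
     (forall x y, P x -> P y -> P (x * y)%R) -> forall b, P b)%classic ->
  noetherian B.
Proof.
elim: xs R h => [|x xs IH] R h noethR gen.
  apply: (noetherian_surj (rmorph0 h) (rmorphD h) (rmorphM h)) noethR.
  apply: (gen [set b | exists a, h a = b]%classic).
  - by move=> r; exists r.
  - by [].
  - by move=> _ _ [a <-] [b <-]; exists (a + b)%R; rewrite rmorphD.
  - by move=> _ _ [a <-] [b <-]; exists (a * b)%R; rewrite rmorphM.
have comm_x : commr_rmorph h x by move=> a; rewrite /GRing.comm mulrC.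
apply: (IH {poly R} (horner_morph comm_x)); first exact: hilbert_basis.
move=> P Ph Pxs PD PM; apply: gen => //.
  by move=> r; have := Ph r%:P%R; rewrite /= horner_morphC.
move=> y /=; rewrite inE => /predU1P[->|]; last exact: Pxs.
by have := Ph 'X%R; rewrite /= horner_morphX.
Qed.

(** * Gluing fractions in depth two *)

Section Depth.
Local Open Scope ring_scope.
Local Open Scope classical_set_scope.
Variable A : comNzRingType.
Implicit Types (J : set A) (x y : A).

Lemma radical_ideal J : is_ideal J -> is_ideal (radical J).
Proof.
move=> HJ; case: (HJ) => J0 JD JM; split.
- by exists 1%N; rewrite expr1.
- move=> x y [a Ja] [b Jb]; exists (a + b)%N.
  rewrite exprDn; apply: is_ideal_sum => // -[i /= _] _; rewrite -mulr_natl.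
  apply: (JM); have [ib|bi] := leqP i b.
    by rewrite -addnBA // exprD -mulrA mulrC; apply: JM.
  by rewrite -(subnK (ltnW bi)) exprD mulrA; apply: JM.
- by move=> a x [k Jx]; exists k; rewrite exprMn; apply: JM.
Qed.

Lemma radical_idealS (J K : set A) : is_ideal K -> J `<=` radical K ->
  radical (ideal_gen J) `<=` radical K.
Proof.
move=> HK JK x [k Jx].
have [l] := ideal_gen_sub (radical_ideal HK) JK Jx.
by rewrite -exprM => Kx; exists (k * l)%N.
Qed.

Lemma ideal_gen1 x y : ideal_gen [set` [:: x]] y -> exists z, y = x * z.
Proof.
suff sub : ideal_gen [set` [:: x]] `<=` [set t | exists z, t = x * z] by exact: sub.
apply: ideal_gen_sub => [|t /=]; last first.
  by rewrite inE => /eqP ->; exists 1; rewrite mulr1.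
split=> /= [|_ _ [u ->] [v ->]|a _ [u ->]]; first by exists 0; rewrite mulr0.
  by exists (u + v); rewrite mulrDr.
by exists (a * u); rewrite mulrCA.
Qed.

(** Powers of a regular pair form a regular pair: raise first the exponent of y,
    then that of x by cancelling one factor x at a time. *)
Lemma regular_pair_exp x y : (forall z, x * z = 0 -> z = 0) ->
  (forall z t, y * z = x * t -> exists u, z = x * u) ->
  forall M N z t, y ^+ M * z = x ^+ N * t -> exists u, z = x ^+ N * u.
Proof.
move=> xr yr M.
have yrM z t : y ^+ M * z = x * t -> exists u, z = x * u.
  elim: M z => [|M IH] z; first by rewrite mul1r => ->; exists t.
  rewrite exprSr -mulrA => /IH[u /yr]; exact.
elim=> [|N IH] z t; first by exists z; rewrite mul1r.
rewrite exprS -mulrA => E; have [u zu] := yrM _ _ E.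
have {}E : y ^+ M * u = x ^+ N * t.
  apply/eqP; rewrite -subr_eq0; apply/eqP/xr; rewrite mulrBr -E zu; ring.
have [w uw] := IH _ _ E; by exists w; rewrite -mulrA -uw.
Qed.

(** Sections of R over the complement of the zero locus of the a i extend to R.
    Once all denominators are a i ^+ K, writing x^N and y^M as combinations of
    the a i ^+ K gives numerators p and q of the glued section over x^N and y^M.
    They satisfy y^M p = x^N q, so regularity makes x^N divide p, and the
    quotient is the section. *)
Lemma depth2_glue x y r (a v : 'I_r -> A) (k : 'I_r -> nat) :
  (forall z, x * z = 0 -> z = 0) ->
  (forall z t, y * z = x * t -> exists u, z = x * u) ->
  radical (ideal_gen (range a)) x -> radical (ideal_gen (range a)) y ->
  (forall i j : 'I_r, (i < j)%N -> exists l : nat,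
     (a i * a j) ^+ l * ((a i * a j) ^+ k j * (a j ^+ k i * v i)
       - (a i * a j) ^+ k i * (a i ^+ k j * v j)) = 0) ->
  exists b K, forall i, (k i <= K)%N /\ a i ^+ K * b = a i ^+ (K - k i) * v i.
Proof.
move=> xr yr ax ay cocycle.
have {cocycle} cocycle (ij : 'I_r * 'I_r) : exists l : nat,
    (a ij.1 * a ij.2) ^+ l * ((a ij.1 * a ij.2) ^+ k ij.2 * (a ij.2 ^+ k ij.1 * v ij.1)
       - (a ij.1 * a ij.2) ^+ k ij.1 * (a ij.1 ^+ k ij.2 * v ij.2)) = 0.
  case: ij => i j /=; case: (ltngtP i j) => [ij|ji|/val_inj <-].
  - exact: cocycle.
  - have [l E] := cocycle _ _ ji; exists l.
    by rewrite [a i * _]mulrC -opprB mulrN E oppr0.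
  - by exists 0%N; rewrite subrr mulr0.
have [l lP] := choice cocycle.
(* The common denominator exponent must absorb l, k i and k j, each at most L. *)
pose L := (\max_ij l ij + \max_i k i)%N; pose K := (L + L + L)%N.
have lL ij : (l ij <= L)%N by rewrite (leq_trans (leq_bigmax ij)) // leq_addr.
have kL i : (k i <= L)%N by rewrite (leq_trans (leq_bigmax i)) // leq_addl.
have kK i : (k i <= K)%N by have := kL i; rewrite /K; lia.
pose w i := a i ^+ (K - k i) * v i.
have wE i j : a j ^+ K * w i = a i ^+ K * w j.
  have [e [eL]] : exists e, (e <= L)%N /\ (a i * a j) ^+ e *
      ((a i * a j) ^+ k j * (a j ^+ k i * v i)
       - (a i * a j) ^+ k i * (a i ^+ k j * v j)) = 0.
    by exists (l (i, j)); split; [apply: lL | apply: (lP (i, j))].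
  have [ki kj] := (kL i, kL j).
  have [m Km] : exists m, K = (e + k i + k j + m)%N.
    by exists (K - (e + k i + k j))%N; rewrite /K; lia.
  rewrite mulrBr => /eqP; rewrite subr_eq0 => /eqP E.
  rewrite /w Km.
  have -> : (e + k i + k j + m - k i = e + k j + m)%N by lia.
  have -> : (e + k i + k j + m - k j = e + k i + m)%N by lia.
  have := congr1 ( *%R ((a i * a j) ^+ m)) E.
  rewrite !exprMn !exprD; set ai := a i; set aj := a j => {}E.
  transitivity (ai ^+ m * aj ^+ m * (ai ^+ e * aj ^+ e *
    (ai ^+ k j * aj ^+ k j * (aj ^+ k i * v i)))); first by ring.
  by rewrite E; ring.
(* D consists of the z for which z times the glued section is an element of A. *)
pose D : set A := [set z | exists p, forall j, a j ^+ K * p = z * w j].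
have HD : is_ideal D.
  split=> [|s t [p Ep] [q Eq]|c s [p Ep]].
  - by exists 0 => j; rewrite mulr0 mul0r.
  - by exists (p + q) => j; rewrite mulrDl mulrDr Ep Eq.
  - by exists (c * p) => j; rewrite -mulrA -Ep mulrCA.
have aD : range a `<=` radical D by move=> _ [i _ <-]; exists K, (w i).
have [N [p Ep]] := radical_idealS HD aD ax.
have [M [q Eq]] := radical_idealS HD aD ay.
have nzd_a z : (forall j, a j ^+ K * z = 0) -> z = 0.
  move=> az; have HZ := ann_ideal z.
  have aZ : range a `<=` radical (ann z).
    by move=> _ [i _ <-]; exists K; apply: az.
  by have [T] := radical_idealS HZ aZ ax; apply: nzd_exp.
have [b pb] : exists b, p = x ^+ N * b.
  apply: (regular_pair_exp xr yr (M := M) (t := q)).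
  apply/eqP; rewrite -subr_eq0; apply/eqP/nzd_a => j.
  by rewrite mulrBr mulrCA Ep [a j ^+ K * _]mulrCA Eq mulrCA subrr.
exists b, K => i; split=> //; apply/eqP; rewrite -subr_eq0; apply/eqP.
by apply: (nzd_exp xr (N := N)); rewrite mulrBr mulrCA -pb Ep subrr.
Qed.

Lemma grade_ge2P J d : grade_ge J d -> (2 <= d)%N ->
  exists x y, [/\ J x, J y, forall z, x * z = 0 -> z = 0 &
    forall z t, y * z = x * t -> exists u, z = x * u].
Proof.
move=> [[|x [|y xs]] [[reg _] xsJ] ds] d2; try by move: (leq_trans d2 ds).
exists x, y; split.
- by apply: xsJ; rewrite /= mem_head.
- by apply: xsJ; rewrite /= !inE eqxx orbT.
- move=> z xz; apply: ideal_gen0; apply: (reg 0%N z) => //=; rewrite xz.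
  by case: (ideal_genP [set` [::] : seq A]).
- move=> z t yz; apply: ideal_gen1; have := reg 1%N z; rewrite /=; apply=> //.
  rewrite yz mulrC; case: (ideal_genP [set` [:: x]]) => _ _; apply.
  by apply: sub_ideal_gen; rewrite /= mem_head.
Qed.

End Depth.

(** * Powers of ideals and filtrations of finite type *)

Section Filtered.
Local Open Scope ring_scope.
Local Open Scope classical_set_scope.

Lemma ideal_mul_subl (R : comPzRingType) (P Q : set R) :
  is_ideal P -> ideal_mul P Q `<=` P.
Proof.
move=> HP; apply: ideal_gen_sub => // _ [u [v [Pu _ ->]]].
by case: HP => _ _ M; rewrite mulrC; apply: M.
Qed.

Lemma ideal_mul_subr (R : comPzRingType) (P Q : set R) :
  is_ideal Q -> ideal_mul P Q `<=` Q.
Proof.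
by move=> HQ; apply: ideal_gen_sub => // _ [u [v [_ Qv ->]]]; case: HQ => _ _; apply.
Qed.

Lemma ideal_pow_add_sub (R : comPzRingType) (J : set R) a b :
  ideal_pow J (a + b) `<=` ideal_mul (ideal_pow J a) (ideal_pow J b).
Proof.
elim: a => [|a IHa]; first by move=> x Jx; rewrite -[x]mul1r; apply: ideal_mulP.
apply: ideal_gen_sub => [|_ [u [v [Ju /IHa Jv ->]]]]; first exact: ideal_genP.
rewrite mulrC; apply: ideal_mul_colon Jv; first exact: ideal_genP.
move=> v1 v2 Jv1 Jv2; rewrite mulrC mulrA; apply: ideal_mulP => //.
exact: ideal_mulP.
Qed.

Variables (R : comNzRingType) (s : nat) (I : 'I_s -> set R).
Implicit Types (n m p q g : zvec s) (K : set R).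

Definition zone : zvec s := [ffun _ => 1].

Lemma zoneM k (i : 'I_s) : (zone *+ k) i = k%:Z.
Proof. by rewrite ffunMnE ffunE natz. Qed.

Lemma zone_ge0 k : zle 0 (zone *+ k).
Proof. by move=> i; rewrite zoneM ffunE. Qed.

Lemma zle_subr_ge0 n m : zle n m -> zle 0 (m - n).
Proof. by move=> nm i; rewrite !ffunE subr_ge0. Qed.

(** Nonnegativity matters: for n = 1 and m = -1 the product of the two powers is
    I while the power of the sum is the whole ring. *)
Lemma multi_pow_add_sub n m : zle 0 n -> zle 0 m ->
  multi_pow I (n + m) `<=` ideal_mul (multi_pow I n) (multi_pow I m).
Proof.
move=> n0 m0; rewrite /multi_pow; elim: (index_enum _) => [|i l IH].
  by rewrite !big_nil => x _; rewrite -[x]mul1r; apply: ideal_mulP.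
rewrite !big_cons; set P := (X in ideal_mul _ X `<=` _).
set Pn := (X in _ `<=` ideal_mul (ideal_mul _ X) _).
set Pm := (X in _ `<=` ideal_mul _ (ideal_mul _ X)).
apply: ideal_gen_sub => [|_ [x [y [Ix Py ->]]]]; first exact: ideal_genP.
have {}Ix : ideal_mul (ideal_zpow (I i) (n i)) (ideal_zpow (I i) (m i)) x.
  move: (n0 i) (m0 i) Ix; rewrite !ffunE.
  by case: (n i) => // a; case: (m i) => // b _ _; apply: ideal_pow_add_sub.
apply: ideal_mul_colon Ix; first exact: ideal_genP.
move=> x1 x2 Ix1 Ix2; rewrite mulrC.
apply: ideal_mul_colon (IH _ Py); first exact: ideal_genP.
move=> y1 y2 Iy1 Iy2; rewrite mulrACA [y1 * _]mulrC [y2 * _]mulrC.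
by apply: ideal_mulP; apply: ideal_mulP.
Qed.

Lemma multi_pow_ind n m K : zle 0 n -> zle 0 m -> is_ideal K ->
  (forall u v, multi_pow I n u -> multi_pow I m v -> K (u * v)) ->
  multi_pow I (n + m) `<=` K.
Proof.
move=> n0 m0 HK Kuv x /(multi_pow_add_sub n0 m0); apply: ideal_gen_sub => //.
by move=> _ [u [v [Iu Iv ->]]]; apply: Kuv.
Qed.

Lemma multi_pow_le n m : zle n m -> multi_pow I m `<=` multi_pow I n.
Proof. by case: (multi_pow_filtration I) => _ _ _; apply. Qed.

Lemma multi_pow_unit1 n : zle n 0 -> multi_pow I n 1.
Proof.
move=> n0; apply: (multi_pow_le n0); rewrite /multi_pow.
elim: (index_enum _) => [|i l IHl]; first by rewrite big_nil.
by rewrite big_cons ffunE -[1]mulr1; apply: ideal_mulP.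
Qed.

Lemma multi_pow_sub n i : is_ideal (I i) -> 0 < n i -> multi_pow I n `<=` I i.
Proof.
move=> HI ni x nx.
have : ideal_zpow (I i) (n i) x.
  move: nx (mem_index_enum i); rewrite /multi_pow; elim: (index_enum _) => [//|j l IHl].
  rewrite big_cons => /= nx; rewrite inE => /predU1P[->|il].
    by apply: ideal_mul_subl nx; apply: ideal_zpowP.
  apply: IHl => //; apply: ideal_mul_subr nx.
  by elim/big_rec: _ => [|k X _ _]; [apply: is_idealT | apply: ideal_genP].
case: (n i) ni => [[|k]|k] //= _; exact: ideal_mul_subl.
Qed.

Lemma sub_multi_pow i : I i `<=` multi_pow I (zunit i).
Proof.
move=> a Ia; rewrite /multi_pow.
have one l : i \notin l -> (\big[@ideal_mul R/setT]_(j <- l)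
    ideal_zpow (I j) (zunit i j)) 1.
  elim: l => [|j l IHl]; first by rewrite big_nil.
  rewrite inE negb_or big_cons ffunE => /andP[ij il].
  rewrite eq_sym (negPf ij) -[1]mulr1.
  by apply: ideal_mulP => //; apply: IHl.
have := mem_index_enum i; have := index_enum_uniq 'I_s.
elim: (index_enum _) => [//|j l IHl] /= /andP[jl ul].
rewrite big_cons ffunE inE; case: (eqVneq i j) jl => [<- il _|ij jl /= il].
  rewrite -[a]mulr1; apply: ideal_mulP; last exact: one.
  by rewrite /= /ideal_pow /= -[a]mulr1; apply: ideal_mulP.
rewrite -[a]mul1r.
by apply: ideal_mulP => //; apply: IHl.
Qed.

Variable F : filtration I.

Lemma fil_ideal n : is_ideal (F n).
Proof. by case: (filtrationP F). Qed.

Lemma fil_pow n : multi_pow I n `<=` F n.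
Proof. by case: (filtrationP F). Qed.

Lemma fil_mul n m x y : F n x -> F m y -> F (n + m) (x * y).
Proof. by case: (filtrationP F) => _ _ M _ Fx Fy; apply: M; apply: ideal_mulP. Qed.

Lemma fil_le n m : zle n m -> F m `<=` F n.
Proof. by case: (filtrationP F) => _ _ _; apply. Qed.

Lemma fil0 n x : zle n 0 -> F n x.
Proof.
move=> /multi_pow_unit1/fil_pow F1; rewrite -[x]mulr1.
by case: (fil_ideal n) => _ _; apply.
Qed.

Lemma fil_exp n x k : F n x -> F (n *+ k) (x ^+ k).
Proof.
move=> Fx; elim: k => [|k IH]; first by apply: fil0.
by rewrite mulrS exprS; apply: fil_mul.
Qed.

(** Equality of F(n) with the degree-n part of the Ratliff-Rush closure of F. *)
Definition saturated n := forall b k,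
  (forall u, multi_pow I (zone *+ k) u -> F (n + zone *+ k) (u * b)) -> F n b.

(** Pigeonhole: a product of T elements of xs, with T larger than the sum of the
    exponents, contains some x at least k x times.  In the induction one factor x
    is absorbed into b, which raises n by e and lowers k x by one. *)
Lemma fil_saturate (xs : seq R) T (k : R -> nat) n b :
  multi_pow I zone = ideal_gen [set` xs] ->
  (\sum_(x <- xs) k x < T)%N ->
  (forall x, x \in xs -> F (n + zone *+ k x) (x ^+ k x * b)) ->
  forall u, multi_pow I (zone *+ T) u -> F (n + zone *+ T) (u * b).
Proof.
move=> Exs; elim: T k n b => [//|T IH] k n b; rewrite ltnS => kT Fxs u.
have HK := colon_ideal b (fil_ideal (n + zone *+ T.+1)).
rewrite {1}mulrS => Iu; have := multi_pow_ind (n := zone) (zone_ge0 1) (zone_ge0 T) HK.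
apply; last exact: Iu; move=> v w; rewrite Exs => xsv Iw.
apply: (@ideal_gen_sub _ [set` xs] [set v | F (n + zone *+ T.+1) (v * w * b)]) xsv.
  exact: (colon_ideal w HK).
move=> x /= xxs; have [kx0|kx] := posnP (k x).
  have := Fxs x xxs; rewrite kx0 mulr0n addr0 mul1r => Fb.
  rewrite mulrC addrC [x * w]mulrC [b * _]mulrC; apply: fil_mul => //.
  rewrite mulrSr; apply: fil_mul; first exact: fil_pow.
  by apply: fil_pow; rewrite Exs; apply: sub_ideal_gen.
(* The other exponents keep their values: only k x decreases. *)
rewrite mulrS addrA [x * w]mulrC -mulrA.
apply: (IH (fun y => k y - (y == x))%N) => // [|y yxs].
  apply: leq_trans kT; rewrite [leqRHS](_ : _ =
      \sum_(y <- xs) (k y - (y == x)) + count_mem x xs)%N.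
    by rewrite -addn1 leq_add2l -has_count has_pred1.
  rewrite -sum1_count [X in (_ + X)%N]big_mkcond -big_split /=; apply: eq_bigr => y _.
  by case: eqP => [->|_]; rewrite ?subnK // subn0 addn0.
have [->|yx] := eqVneq y x; last first.
  rewrite subn0 mulrCA addrAC addrC; apply: fil_mul (Fxs y yxs).
  by apply: fil_pow; rewrite Exs; apply: sub_ideal_gen.
rewrite mulrA -exprSr subn1 prednK // -addrA -mulrS prednK //.
exact: Fxs.
Qed.

(** The components of the finitely many module generators give finitely many
    homogeneous ones v, of degree g, and F(n) is the sum of the I^(n - g) v.  The
    last clause says so as an induction principle for ideals. *)
Lemma ext_rees_gens : extended_rees_finite I F ->
  exists L : seq (zvec s * R), (forall g : zvec s * R, g \in L -> F g.1 g.2) /\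
  forall n f K, F n f -> is_ideal K ->
    (forall (g : zvec s * R) u, g \in L -> multi_pow I (n - g.1) u -> K (u * g.2)) -> K f.
Proof.
move=> [r [g [Fg gen]]].
have supp j : exists xs : seq (zvec s), [set n | g j n != 0] = [set` xs].
  by apply/cardinality.finite_seqP; case: (Fg j).
have {supp} [supp suppP] := choice supp.
pose L := flatten [seq [seq (p, g j p) | p <- supp j] | j <- enum 'I_r].
exists L; split=> [_ /flatten_mapP[j _ /mapP[p _ ->]]|n f K Ff HK Kgen].
  by case: (Fg j) => _; apply.
(* The monomial f t^n, written as a Laurent polynomial. *)
pose t m := if m == n then f else 0.
have [|a [Fa tE]] := gen t.
  split=> [|m]; last first.
    by rewrite /t; case: eqP => [->//|_]; case: (fil_ideal m).
  apply/cardinality.finite_seqP; exists (if f == 0 then [::] else [:: n]).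
  rewrite eqEsubset; split=> m; rewrite /t /=; case: (m =P n) => [->|mn].
  - by move=> /negPf ->; rewrite mem_head.
  - by rewrite eqxx.
  - by case: (f == 0).
  - by case: (f == 0) => //; rewrite inE => /eqP.
have -> : f = t n by rewrite /t eqxx.
rewrite tE; apply: is_ideal_sum => // j _; apply: is_ideal_sum => // m _.
have [->|gm] := eqVneq (g j (n - m)) 0; first by rewrite mulr0; case: HK.
apply: (Kgen (n - m, g j (n - m)) (a j m)) => /=; last first.
  by rewrite opprB addrC subrK; case: (Fa j).
apply/flatten_mapP; exists j; first by rewrite mem_enum.
apply/mapP; exists (n - m) => //.
by have : [set n | g j n != 0] (n - m) by []; rewrite suppP.
Qed.

Lemma degree_bound (L : seq (zvec s * R)) :
  exists c : nat, forall (g : zvec s * R) i, g \in L -> (`|g.1 i| <= c)%N.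
Proof.
exists (\max_(g <- L) \max_(j < s) `|g.1 j|)%N => g i gL.
apply: leq_trans (leq_bigmax (F := fun j => `|g.1 j|%N) i) _.
exact: (@leq_bigmax_seq _ _ xpredT
  (fun g : zvec s * R => \max_(j < s) `|g.1 j|)%N).
Qed.

(** If F(e_i) = R then F(k e_i) = R for all k; but by finiteness F(k e_i) is
    inside I_i once k exceeds the i-th degrees of the generators. *)
Lemma fil_unit_proper i : extended_rees_finite I F -> is_ideal (I i) ->
  ~ I i 1 -> ~ F (zunit i) 1.
Proof.
move=> /ext_rees_gens[L [FL Lgen]] HI I1 F1.
have F1k k : F (zunit i *+ k) 1.
  elim: k => [|k IHk]; first by apply: fil0 => j; rewrite !ffunE.
  by rewrite mulrS -[1]mulr1; apply: fil_mul.
have [c gc] := degree_bound L.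
apply: I1; apply: (Lgen _ _ _ (F1k c.+1) HI) => g u gL.
have : 0 < (zunit i *+ c.+1 - g.1) i.
  rewrite !ffunE ffunMnE ffunE eqxx natz; have := gc g i gL; move: (g.1 i) => x; lia.
move=> /(multi_pow_sub HI) /[apply] Iu.
by case: HI => _ _ M; rewrite mulrC; apply: M.
Qed.

End Filtered.

Arguments zone {s}.

(** * Rees rings and Cech cocycles *)

Section Rees.
Local Open Scope ring_scope.
Local Open Scope classical_set_scope.
Variables (R : comNzRingType) (s : nat) (I : 'I_s -> set R).
Implicit Types (m q : 'X_{1..s}) (n : zvec s) (b c x y : R).

Definition znat n : 'X_{1..s} := [multinom `|n i|%N | i < s].

Lemma znatK n : zle 0 n -> zdeg (znat n) = n.
Proof. by move=> n0; apply/ffunP => i; have := n0 i; rewrite !ffunE mnmE; apply: gez0_abs. Qed.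

Lemma zdegK m : znat (zdeg m) = m.
Proof. by apply/mnmP => i; rewrite mnmE ffunE. Qed.

Lemma zdeg_inj : injective (@zdeg s).
Proof. exact: can_inj zdegK. Qed.

Lemma zdeg_ge0 m : zle 0 (zdeg m).
Proof. by move=> i; rewrite !ffunE. Qed.

Definition mone : 'X_{1..s} := [multinom 1%N | i < s].

Lemma zdeg_mone k : zdeg (mone *+ k)%MM = zone *+ k.
Proof.
apply/ffunP => i; rewrite zoneM ffunE.
by rewrite mulmnE mnmE mul1n.
Qed.

Lemma zdeg_mone1 : zdeg mone = zone.
Proof. by rewrite -[mone]mulm1n zdeg_mone. Qed.

Section OneFiltration.
Variable F : filtration I.
Implicit Types (p : rees F).

Lemma rees_valD (p p' : rees F) : rees_val (p + p') = rees_val p + rees_val p'.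
Proof. by []. Qed.

Lemma rees_valB (p p' : rees F) : rees_val (p - p') = rees_val p - rees_val p'.
Proof. by []. Qed.

Lemma rees_valM (p p' : rees F) : rees_val (p * p') = rees_val p * rees_val p'.
Proof. by []. Qed.

Lemma rees_valX p k : rees_val (p ^+ k) = rees_val p ^+ k.
Proof. by elim: k => [//|k IH]; rewrite !exprS rees_valM IH. Qed.

(** The monomial c t^m, which is meaningful when c is in F(m) and 0 otherwise. *)
Definition mono m c : rees F := insubd 0 (c *: 'X_[m] : {mpoly R[s]}).

Lemma monoE m c : F (zdeg m) c -> rees_val (mono m c) = c *: 'X_[m].
Proof.
move=> Fc; rewrite [LHS](insubdK (0 : rees F)) //; apply/rees_predP => q.
rewrite mcoeffZ mcoeffX; case: eqP => [<-|_]; first by rewrite mulr1.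
by rewrite mulr0; case: (fil_ideal F (zdeg q)).
Qed.

Lemma rees_monoE p : p = \sum_(m <- msupp (rees_val p)) mono m (rees_val p)@_m.
Proof.
apply: val_inj; rewrite /= [LHS]mpolyE.
rewrite (big_morph (@rees_val _ _ _ F) rees_valD (erefl _ : rees_val (0 : rees F) = 0)).
by apply: eq_bigr => m _; rewrite monoE //; apply: reesP.
Qed.

Lemma mono0 m : mono m 0 = 0.
Proof.
by apply: val_inj; rewrite /= monoE ?scale0r //; case: (fil_ideal F (zdeg m)).
Qed.

Lemma monoD m c c' : F (zdeg m) c -> F (zdeg m) c' ->
  mono m (c + c') = mono m c + mono m c'.
Proof.
move=> Fc Fc'; apply: val_inj; rewrite /= !monoE ?scalerDl //.
by case: (fil_ideal F (zdeg m)) => _ + _; apply.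
Qed.

Lemma monoM m m' c c' : F (zdeg m) c -> F (zdeg m') c' ->
  mono (m + m') (c * c') = mono m c * mono m' c'.
Proof.
move=> Fc Fc'; apply: val_inj; rewrite /= !monoE // ?mpolyXD.
  by rewrite -scalerAl -scalerAr scalerA.
by rewrite zdegD; apply: fil_mul.
Qed.

(** To prove P for all the monomials of degree m with coefficient in an ideal, it
    is enough to do so for generators of that ideal. *)
Lemma mono_ideal (P : set (rees F)) m : P 0 ->
  (forall p p', P p -> P p' -> P (p + p')) ->
  (forall c p, P p -> P (mono 0%MM c * p)) ->
  is_ideal [set c | F (zdeg m) c /\ P (mono m c)].
Proof.
move=> P0 PD PM; have [F0 FD FM] := fil_ideal F (zdeg m).
split=> /= [|c c' [Fc Pc] [Fc' Pc']|a c [Fc Pc]]; first by rewrite mono0.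
  by rewrite monoD //; split; [apply: FD | apply: PD].
split; first exact: FM.
rewrite -[m]add0m monoM //; first exact: PM.
by rewrite zdeg0; apply: fil0 => i.
Qed.

Lemma mcoeff_cX c m q : (c *: 'X_[m] : {mpoly R[s]})@_q = c * (m == q)%:R.
Proof. by rewrite mcoeffZ mcoeffX. Qed.

Lemma mcoeffM_neq0 (f g : {mpoly R[s]}) q : (f * g)@_q != 0 ->
  exists q1 q2, [/\ q = (q1 + q2)%MM, f@_q1 != 0 & g@_q2 != 0].
Proof.
rewrite -mcoeff_msupp => /msuppM_le/allpairsP[[q1 q2] /= [f1 g2 ->]].
by exists q1, q2; rewrite -!mcoeff_msupp.
Qed.

(** Evaluation at t = 1, the ring morphism that brings a computation between
    homogeneous elements back to R. *)
Definition ev p : R := (rees_val p).@[fun=> 1].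

Lemma evD (p p' : rees F) : ev (p + p') = ev p + ev p'.
Proof. exact: mevalD. Qed.

Lemma evB (p p' : rees F) : ev (p - p') = ev p - ev p'.
Proof. exact: mevalB. Qed.

Lemma evM (p p' : rees F) : ev (p * p') = ev p * ev p'.
Proof. exact: mevalM. Qed.

Lemma evX p k : ev (p ^+ k) = ev p ^+ k.
Proof. by elim: k => [|k IH]; [apply: meval1 | rewrite !exprS evM IH]. Qed.

Lemma mevalcX c m : (c *: 'X_[m] : {mpoly R[s]}).@[fun=> 1] = c.
Proof. by rewrite mevalZ mevalX big1 ?mulr1 // => i _; rewrite expr1n. Qed.

Lemma ev_mono m c : F (zdeg m) c -> ev (mono m c) = c.
Proof. by move=> Fc; rewrite /ev monoE // mevalcX. Qed.

(** A homogeneous element is recovered from its degree and its value at t = 1. *)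
Lemma rees_homogE m p : rees_homog F (zdeg m) p -> rees_val p = ev p *: 'X_[m].
Proof.
move=> hp; have E : rees_val p = (rees_val p)@_m *: 'X_[m].
  apply/mpolyP => q; rewrite mcoeff_cX.
  have [<-|mq] := eqVneq m q; first by rewrite mulr1.
  rewrite mulr0; apply/eqP/contraT => /hp/zdeg_inj qm; by rewrite qm eqxx in mq.
by rewrite /ev {2}E mevalcX.
Qed.

Lemma rees_homog_ev m p : rees_homog F (zdeg m) p -> F (zdeg m) (ev p).
Proof.
move=> /rees_homogE E; have := reesP p m.
by rewrite E mcoeff_cX eqxx mulr1.
Qed.

Lemma rees_homog_mono m c : rees_homog F (zdeg m) (mono m c).
Proof.
move=> q; rewrite /mono val_insubd; case: ifP => _; last by rewrite mcoeff0 eqxx.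
by rewrite mcoeff_cX; case: (eqVneq m q) => [->//|_]; rewrite mulr0 eqxx.
Qed.

Lemma rees_pp_mono c : rees_pp F (mono mone c).
Proof.
move=> q /rees_homog_mono; rewrite zdeg_mone1 => qE i.
by have := zoneM 1 i; rewrite mulr1n -qE ffunE => -[->].
Qed.

Lemma rees_pp_ideal : is_ideal (rees_pp F).
Proof.
split=> [q|p p' hp hp' q|a p hp q].
- by rewrite mcoeff0 eqxx.
- rewrite rees_valD mcoeffD => nz; have [p0|/hp//] := eqVneq (rees_val p)@_q 0.
  by apply: hp'; move: nz; rewrite p0 add0r.
- rewrite rees_valM => /mcoeffM_neq0[q1 [q2 [-> _ /hp q20]]] i.
  by rewrite mnmDE ltn_addl.
Qed.

Lemma rees_pp_exp p k q : rees_pp F p -> (rees_val p ^+ k)@_q != 0 ->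
  zle (zone *+ k) (zdeg q).
Proof.
move=> hp; elim: k q => [|k IH] q; first by move=> _; apply: zdeg_ge0.
rewrite exprS => /mcoeffM_neq0[q1 [q2 [-> /hp q10 /IH q2k]]] i.
by have := q2k i; have := q10 i; rewrite !zoneM !ffunE mnmDE; lia.
Qed.

Lemma rees_homog_exp n p k q : rees_homog F n p -> (rees_val p ^+ k)@_q != 0 ->
  zdeg q = n *+ k.
Proof.
move=> hp; elim: k q => [|k IH] q.
  by rewrite mcoeff1; case: (eqVneq q 0%MM) => [-> _|]; [apply: zdeg0 | rewrite eqxx].
rewrite exprS => /mcoeffM_neq0[q1 [q2 [-> /hp q1n /IH q2k]]].
by rewrite zdegD q1n q2k mulrS.
Qed.

End OneFiltration.

Variable F : filtration I.
Local Notation A := (rees (adic_filtration I)).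

Lemma evZ (a : A) (p : rees F) : ev (a *: p) = ev a * ev p.
Proof. exact: mevalM. Qed.

Lemma ev_preim_ideal (K : set R) : is_ideal K -> is_ideal [set a : A | K (ev a)].
Proof.
case=> K0 KD KM; split=> /= [|a b Ka Kb|a b Kb]; first by rewrite /ev meval0.
  by rewrite evD; apply: KD.
by rewrite evM; apply: KM.
Qed.

(** If I^(ke) b is contained in F(n + ke), the fractions x_i^k b t^n / x_i^k form
    a cocycle; a preimage u in F(n) agrees with b up to torsion for the powers of
    the x_i, hence for a power of the nonzerodivisor x. *)
Lemma H1_saturated m x : (forall z, x * z = 0 -> z = 0) ->
  radical (multi_pow I zone) x -> H1_rees_eq0 F (zdeg m) -> saturated F (zdeg m).
Proof.
move=> xr [N xI] [r [X [d [Xhom JX cech]]]] b k Fb.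
have Xpp i : rees_pp (adic_filtration I) (X i).
  by rewrite JX; apply: sub_ideal_gen; exists i.
have mem i : rees_val (X i) ^+ k * (b *: 'X_[m]) \in rees_pred F.
  apply/rees_predP => q; rewrite mcoeffM; apply: is_ideal_sum.
    exact: fil_ideal.
  case=> u v /= /eqP E; rewrite {1}E mcoeff_cX.
  move: (bmnm u) (bmnm v) => {E u v} q1 q2.
  have [F0 _ _] := fil_ideal F (zdeg (q1 + q2)%MM).
  have [<-|_] := eqVneq m q2; last by rewrite !mulr0.
  have [->|nz] := eqVneq (rees_val (X i) ^+ k)@_q1 0.
    by rewrite mul0r; case: (fil_ideal F (zdeg (q1 + m)%MM)).
  have q1k := rees_pp_exp (Xpp i) nz.
  rewrite mulr1; have : multi_pow I (zdeg q1) (rees_val (X i) ^+ k)@_q1.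
    by rewrite -rees_valX; exact: (reesP (X i ^+ k) q1).
  have HK := colon_ideal b (fil_ideal F (zdeg (q1 + m)%MM)).
  rewrite -{1}[zdeg q1](subrK (zone *+ k)).
  move: (_@__) => c; apply: (multi_pow_ind _ _ HK).
  - exact: zle_subr_ge0.
  - exact: zone_ge0.
  move=> u v Iu /Fb Fv /=.
  have -> : zdeg (q1 + m)%MM = zdeg q1 - zone *+ k + (zdeg m + zone *+ k).
    by rewrite zdegD [zdeg m + zone *+ k]addrC addrA subrK.
  by rewrite -mulrA; apply: fil_mul => //; apply: fil_pow.
(* Each fraction has degree n since the powers of X i cancel. *)
have [||u uhom bd] := cech (fun i => (Rees (mem i), k)).
- move=> i q /= /mcoeffM_neq0[q1 [q2 [-> /(rees_homog_exp (Xhom i)) q1k]]].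
  rewrite mcoeff_cX; case: (eqVneq m q2) => [<- _|_]; last by rewrite mulr0 eqxx.
  by rewrite zdegD q1k addrC.
- move=> i j _; exists 0%N; rewrite /frac_map /=; apply: val_inj.
  by rewrite /= !rees_valX [rees_val (X j) ^+ k * (_ * _)]mulrCA subrr mulr0.
suff -> : b = ev u by apply: rees_homog_ev.
have HZ := ann_ideal (ev u - b).
(* The generators X i act nilpotently on u - b t^n, and so does all of R_++. *)
have X0 i : radical (ann (ev u - b)) (ev (X i)).
  have [l /= E] := bd i; exists (l + k)%N; rewrite /ann /=.
  have := congr1 (@ev _) E; rewrite evZ.
  rewrite evB !evZ !evX expr0 mul1r => {}E.
  have evb : ev (Rees (mem i)) = ev (X i) ^+ k * b.
    by rewrite [LHS]mevalM mevalcX rmorphXn.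
  by rewrite exprD -mulrA mulrBr -evb E [ev 0]meval0.
have /= [M xM] : radical (ann (ev u - b)) (x ^+ N).
  have xA : adic_filtration I (zdeg mone) (x ^+ N) by rewrite zdeg_mone1.
  rewrite -(ev_mono xA).
  have : rees_pp (adic_filtration I) (mono (adic_filtration I) mone (x ^+ N)).
    exact: rees_pp_mono.
  rewrite JX; apply: (ideal_gen_sub (ev_preim_ideal (radical_ideal HZ))).
  by move=> _ [i _ <-]; apply: X0.
by apply/esym/eqP; rewrite -subr_eq0; apply/eqP/(nzd_exp xr (N := N * M)); rewrite exprM.
Qed.

(** The cohomology is computed on the generators a_i t^e, where the a_i generate
    I^e.  A cocycle glues to some b in R by depth, and saturation puts b in F(n). *)
Lemma saturated_H1 m (xs : seq R) x y :
  multi_pow I zone = ideal_gen [set` xs] ->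
  (forall z, x * z = 0 -> z = 0) ->
  (forall z t, y * z = x * t -> exists u, z = x * u) ->
  radical (multi_pow I zone) x -> radical (multi_pow I zone) y ->
  saturated F (zdeg m) -> H1_rees_eq0 F (zdeg m).
Proof.
move=> Exs xr yr Ix Iy sat.
pose a (i : 'I_(size xs)) := xs`_i.
have xsE : [set` xs] = range a.
  rewrite eqEsubset; split=> [z /= /(nthP 0)[i ix <-]|_ [i _ <-]].
    by exists (Ordinal ix).
  exact: mem_nth.
have Ia i : adic_filtration I (zdeg mone) (a i).
  by rewrite zdeg_mone1 /= Exs xsE; apply: sub_ideal_gen; exists i.
pose X i : A := mono (adic_filtration I) mone (a i).
have XE i : rees_val (X i) = a i *: 'X_[mone] by apply: monoE.
exists (size xs), X, (fun=> zone); split.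
- by move=> i; rewrite -zdeg_mone1; apply: rees_homog_mono.
- rewrite eqEsubset; split; last first.
    apply: ideal_gen_sub; first exact: rees_pp_ideal.
    by move=> _ [i _ <-]; apply: rees_pp_mono.
  move=> p pp; rewrite (rees_monoE p); rewrite big_seq; apply: is_ideal_sum.
    exact: ideal_genP.
  move=> q; rewrite mcoeff_msupp => /pp q0.
  have HX := ideal_genP (range X); have [X0 XD XM] := HX.
  have /= := reesP p q; move: (_@__) => c.
  have qz : zle zone (zdeg q) by move=> i; rewrite !ffunE; apply: q0.
  have q1 : zdeg (q - mone)%MM = zdeg q - zone.
    apply/ffunP => i; rewrite !ffunE mnmBE mnmE.
    by have := q0 i; move: (q i) => j; lia.
  have J1 v : multi_pow I zone v -> ideal_gen (range X) (mono (adic_filtration I) mone v).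
    move=> Iv; suff [] : [set c | adic_filtration I (zdeg mone) c /\
        ideal_gen (range X) (mono (adic_filtration I) mone c)] v by [].
    move: v Iv; rewrite Exs xsE; apply: ideal_gen_sub.
      by apply: mono_ideal => // a' p' ?; apply: XM.
    by move=> _ [i _ <-]; split=> //; apply: sub_ideal_gen; exists i.
  suff sub : multi_pow I (zdeg q) `<=` [set c | adic_filtration I (zdeg q) c /\
      ideal_gen (range X) (mono (adic_filtration I) q c)] by move=> /sub[].
  rewrite -{1}[zdeg q](subrK zone); apply: multi_pow_ind.
  + exact: zle_subr_ge0.
  + exact: (zone_ge0 1).
  + by apply: mono_ideal => // a' p' ?; apply: XM.
  move=> u v Iu Iv.
  have qE : q = (q - mone + mone)%MM.
    by apply/mnmP => i; rewrite mnmDE mnmBE mnmE subnK.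
  have Au : adic_filtration I (zdeg (q - mone)%MM) u by rewrite q1.
  have Av : adic_filtration I (zdeg mone) v by rewrite zdeg_mone1.
  split; first by rewrite qE zdegD; apply: fil_mul.
  by rewrite qE monoM //; apply: XM; apply: J1.
move=> c chom cocycle.
pose k i := (c i).2; pose v i := ev (c i).1.
have degE j : zdeg m + zone *+ j = zdeg (m + mone *+ j)%MM by rewrite zdegD zdeg_mone.
have cE i : rees_val (c i).1 = v i *: 'X_[m + mone *+ k i].
  by apply: rees_homogE; rewrite -degE; apply: chom.
have Fv i : F (zdeg m + zone *+ k i) (v i).
  by rewrite degE; apply: rees_homog_ev; rewrite -degE; apply: chom.
have evXa i : ev (X i) = a i by apply: ev_mono.
have [b [K bK]] : exists b K, forall i,
    (k i <= K)%N /\ a i ^+ K * b = a i ^+ (K - k i) * v i.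
  apply: (depth2_glue xr yr); rewrite -?xsE -?Exs // => i j ij.
  have [l E] := cocycle i j ij; exists l.
  have := congr1 (@ev _) E.
  by rewrite /frac_map /= evZ evB !evZ !evX evM !evXa [ev 0]meval0.
(* All the exponents are K, so the pigeonhole bound is r K + 1 for r generators. *)
have Fb : F (zdeg m) b.
  apply: (sat b (\sum_(x <- xs) K).+1) => u.
  apply: (fil_saturate (k := fun=> K) Exs) => // z.
  have : z \in xs -> [set` xs] z by [].
  rewrite xsE => /[apply] -[i _ <-]; have [kK ->] := bK i.
  rewrite -(subnK kK) mulrnDr addrCA addnK; apply: fil_mul => //.
  by apply: fil_pow; apply: (fil_exp (F := adic_filtration I)); rewrite -zdeg_mone1.
exists (mono F m b); first exact: rees_homog_mono.
move=> i; exists (K - k i)%N; have [_ bKi] := bK i.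
apply: val_inj; rewrite /= !rees_valX XE cE monoE // mul1r !exprZn !mpolyXn.
have -> : a i ^+ k i *: 'X_[mone *+ k i] * (b *: 'X_[m]) =
    (a i ^+ k i * b) *: 'X_[m + mone *+ k i] :> {mpoly R[s]}.
  by rewrite -scalerAl -scalerAr scalerA -mpolyXD addmC.
rewrite -scalerBl -scalerAl -scalerAr scalerA mulrBr mulrA -exprD subnK ?bKi.
  by rewrite subrr scale0r.
by case: (bK i).
Qed.

End Rees.

Arguments mone {s}.

(** * The Rees ring is Noetherian, and so are the associated graded rings *)

Section AssociatedGradedRing.
Local Open Scope ring_scope.
Local Open Scope classical_set_scope.
Variables (R : comNzRingType) (s : nat) (I : 'I_s -> set R) (F : filtration I).
Implicit Types (m p q : 'X_{1..s}) (b c u v : R).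

Lemma mnm_ind (P : 'X_{1..s} -> Prop) : P 0%MM ->
  (forall m i, P m -> P (m + U_(i))%MM) -> forall m, P m.
Proof.
move=> P0 PS m; move: {2}(mdeg m) (erefl (mdeg m)) => k.
elim: k m => [|k IH] m mk; first by move/eqP: mk; rewrite mdeg_eq0 => /eqP ->.
have [i mi] : exists i, (0 < m i)%N.
  apply: contrapT => m0; suff m00 : m = 0%MM by rewrite m00 mdeg0 in mk.
  apply/mnmP => i; rewrite mnm0E; apply/eqP; rewrite -leqn0 leqNgt.
  by apply/negP => mi; apply: m0; exists i.
have mE : m = (m - U_(i) + U_(i))%MM.
  by apply/mnmP => j; rewrite mnmDE mnmBE mnm1E; case: eqP => [<-|_]; lia.
rewrite mE; apply: PS; apply: IH.
by move: mk; rewrite {1}mE mdegD mdeg1; lia.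
Qed.

Lemma zdegU (i : 'I_s) : zdeg U_(i) = zunit i.
Proof. by apply/ffunP => j; rewrite !ffunE mnm1E eq_sym. Qed.

Lemma multi_pow_zpos n : multi_pow I (zpos n) = multi_pow I n.
Proof.
by apply: eq_bigr => i _; rewrite ffunE; case: (n i) => // k; rewrite maxElt.
Qed.

Definition rees_const c : rees F := mono F 0%MM c.

Lemma fil_zdeg0 c : F (zdeg 0%MM) c.
Proof. by rewrite zdeg0; apply: fil0 => i. Qed.

Fact rees_const_zmod_morphism : zmod_morphism rees_const.
Proof.
move=> a b; apply: val_inj; rewrite /= !monoE ?scalerBl //; exact: fil_zdeg0.
Qed.

Fact rees_const_monoid_morphism : monoid_morphism rees_const.
Proof.
split=> [|a b].
  by apply: val_inj; rewrite /= monoE ?scale1r ?mpolyX0 //; apply: fil_zdeg0.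
rewrite /rees_const -monoM ?addm0 //; exact: fil_zdeg0.
Qed.

HB.instance Definition _ := GRing.isZmodMorphism.Build R (rees F) rees_const
  rees_const_zmod_morphism.
HB.instance Definition _ := GRing.isMonoidMorphism.Build R (rees F) rees_const
  rees_const_monoid_morphism.

(** Ring generators over R: the a t_i with a among generators of I_i, and the
    v t^p for module generators v of degree g and p in a box containing the
    positive parts of all the degrees g.  The box is needed because g may be
    incomparable with the degree q at hand: v then serves in degree min(g^+, q),
    which is at most g^+, so that F(g) = F(g^+) provides v t^p. *)
Lemma rees_noetherian : noetherian R -> (forall i, is_ideal (I i)) ->
  admissible F -> noetherian (rees F).
Proof.
move=> noethR HI [Fpos /ext_rees_gens[L [FL Lgen]]].
have [a aE] := choice (fun i => noethR _ (HI i)).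
have [c gc] := degree_bound L.
pose gens1 := flatten [seq [seq mono F U_(i)%MM v | v <- a i] | i <- enum 'I_s].
pose box := enum {ffun 'I_s -> 'I_c.+1}.
pose gens2 := flatten [seq [seq
    mono F [multinom ((e : {ffun 'I_s -> 'I_c.+1}) j : nat) | j < s] g.2
  | e <- box] | g : zvec s * R <- L].
apply: (@noetherian_finite_type R (rees F) rees_const (gens1 ++ gens2) noethR).
move=> P Pc Pgens PD PM.
have P0 : P 0 by rewrite -(mono0 F 0%MM); apply: Pc.
have Kid q : is_ideal [set f | F (zdeg q) f /\ P (mono F q f)].
  by apply: mono_ideal => // r p; apply: PM; apply: Pc.
have Pone i v : I i v -> P (mono F U_(i)%MM v).
  suff sub : I i `<=` [set f | F (zdeg U_(i)) f /\ P (mono F U_(i)%MM f)].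
    by move=> /sub[].
  rewrite aE; apply: ideal_gen_sub => // w wa; split.
    rewrite zdegU; apply: fil_pow; apply: sub_multi_pow.
    by rewrite aE; apply: sub_ideal_gen.
  apply: Pgens; rewrite /= mem_cat; apply/orP; left.
  apply/flatten_mapP; exists i; first by rewrite mem_enum.
  exact: map_f.
have Padic q : forall u, multi_pow I (zdeg q) u -> P (mono F q u).
  elim/mnm_ind: q => [u _|q i IH u]; first exact: Pc.
  suff sub : multi_pow I (zdeg (q + U_(i))%MM) `<=`
      [set f | F (zdeg (q + U_(i))%MM) f /\ P (mono F (q + U_(i))%MM f)].
    by move=> /sub[].
  rewrite {1}zdegD zdegU; apply: multi_pow_ind => //.
  - exact: zdeg_ge0.
  - by rewrite -zdegU; apply: zdeg_ge0.
  move=> v w Iv Iw; have Fv := fil_pow F Iv; have := fil_pow F Iw.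
  rewrite -zdegU => Fw; split; first by rewrite zdegD; apply: fil_mul.
  rewrite monoM //; apply: PM; first exact: IH.
  by apply: Pone; apply: multi_pow_sub Iw => //; rewrite ffunE eqxx.
have PF q f : F (zdeg q) f -> P (mono F q f).
  move=> Ff; suff [] : [set f | F (zdeg q) f /\ P (mono F q f)] f by [].
  apply: Lgen Ff (Kid q) _ => g u gL.
  pose p : 'X_{1..s} := [multinom minn `|Num.max (g.1 j) 0| (q j) | j < s].
  have qE : q = (q - p + p)%MM.
    by apply/mnmP => j; rewrite mnmDE mnmBE mnmE subnK // geq_minr.
  rewrite -multi_pow_zpos => Iu.
  have {}Iu : multi_pow I (zdeg (q - p)%MM) u.
    apply: multi_pow_le Iu => j; rewrite !ffunE mnmBE mnmE.
    by move: (g.1 j) (q j) => x y; lia.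
  have Fg : F (zdeg p) g.2.
    have := FL g gL; rewrite Fpos; apply: fil_le => j; rewrite !ffunE mnmE.
    by move: (g.1 j) (q j) => x y; lia.
  have Fu := fil_pow F Iu.
  split; first by rewrite qE zdegD; apply: fil_mul.
  rewrite qE monoM //; apply: PM; first exact: Padic.
  apply: Pgens; rewrite /= mem_cat; apply/orP; right.
  apply/flatten_mapP; exists g => //.
  apply/mapP; exists [ffun j => inord (p j)]; first by rewrite mem_enum.
  congr mono; apply/mnmP => j; rewrite [RHS]mnmE ffunE inordK // ltnS.
  rewrite mnmE (leq_trans (geq_minl _ _)) //.
  by have := gc g j gL; move: (g.1 j) => x; lia.
move=> p; rewrite (rees_monoE p); apply: big_ind => // q _.
by apply: PF; apply: reesP.
Qed.

Variable i : 'I_s.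
Local Notation G := (assoc_ring F i).
Local Notation pi := (@assoc_pi R s I F i).

Lemma assoc_pi_mul (p q : rees F) : pi (p * q) = pi p * pi q.
Proof. by rewrite -assoc_piM. Qed.

Lemma assoc_pi_add (p q : rees F) : pi (p + q) = pi p + pi q.
Proof. exact: assoc_piD. Qed.

Lemma assoc_pi0 : pi 0 = 0.
Proof. by apply: (addrI (pi 0)); rewrite -assoc_pi_add !addr0. Qed.

Lemma assoc_piX (p : rees F) k : pi (p ^+ k) = pi p ^+ k.
Proof. by elim: k => [//|k IH]; rewrite !exprS assoc_pi_mul IH. Qed.

Lemma assoc_pi_eq0 (p : rees F) :
  pi p = 0 <-> forall m, F (zdeg m + zunit i) (rees_val p)@_m.
Proof.
rewrite -assoc_pi0; split=> [/assoc_piP|Fp].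
  by rewrite subr0 => /shift_predP.
by apply/assoc_piP; rewrite subr0; apply/shift_predP.
Qed.

Lemma assoc_pi_surj (z : G) : exists p : rees F, pi p = z.
Proof. by exists (repr (z : {ideal_quot (@shift_pred R s I F i)})%qT); apply: assoc_reprK. Qed.

Lemma assoc_noetherian : noetherian (rees F) -> noetherian G.
Proof.
apply: (noetherian_surj (f := pi)).
- exact: assoc_pi0.
- exact: assoc_pi_add.
- exact: assoc_pi_mul.
- exact: assoc_pi_surj.
Qed.

Lemma assoc_pp_ideal : is_ideal (assoc_pp F i).
Proof.
have [J0 JD JM] := rees_pp_ideal F; split.
- by exists 0 => //; apply: assoc_pi0.
- move=> _ _ [p pp <-] [q qq <-]; exists (p + q); [exact: JD | exact: assoc_pi_add].
- move=> z _ [p pp <-]; have [w <-] := assoc_pi_surj z.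
  by exists (w * p); [exact: JM | exact: assoc_pi_mul].
Qed.

End AssociatedGradedRing.
(** * Grade of the associated graded rings and saturation *)

Section Grade.
Local Open Scope ring_scope.
Local Open Scope classical_set_scope.
Variables (R : comNzRingType) (s : nat) (I : 'I_s -> set R) (F : filtration I).
Implicit Types (m p q : 'X_{1..s}) (b c u v : R).

(** A high power p^N of an element p of R(F)_++ has its coefficients in F(q) with
    q large, hence in I^(ke) F(q - ke) by finiteness, so that it multiplies b t^m
    into the ideal of which G_i(F) is the quotient. *)
Lemma grade_step (i : 'I_s) m k b : extended_rees_finite I F ->
  grade_ge (assoc_pp F i) 1 -> F (zdeg m) b ->
  (forall u, multi_pow I (zone *+ k) u ->
     F (zdeg m + zunit i + zone *+ k) (u * b)) ->
  F (zdeg m + zunit i) b.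
Proof.
move=> /ext_rees_gens[L [FL Lgen]] /grade_ge1P[_ [p pp <-] xreg] Fb Ib.
have [c gc] := degree_bound L.
have bE := monoE Fb.
suff : assoc_pi i (mono F m b) = 0.
  by move=> /assoc_pi_eq0/(_ m); rewrite bE mcoeff_cX eqxx mulr1.
(* Since c bounds the degrees of the module generators, k + c leaves I^(ke). *)
apply: (nzd_exp xreg (N := (k + c)%N)); rewrite -assoc_piX -assoc_pi_mul.
apply/assoc_pi_eq0 => q; rewrite rees_valM rees_valX bE mcoeffM.
apply: is_ideal_sum; first exact: fil_ideal.
case=> v w /= /eqP E; rewrite {1}E mcoeff_cX.
move: (bmnm v) (bmnm w) => {E v w} q1 q2.
have [<-|_] := eqVneq m q2; last first.
  by rewrite !mulr0; case: (fil_ideal F (zdeg (q1 + q2)%MM + zunit i)).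
rewrite mulr1 zdegD -addrA.
have [->|nz] := eqVneq (rees_val p ^+ (k + c))@_q1 0.
  by rewrite mul0r; case: (fil_ideal F (zdeg q1 + (zdeg m + zunit i))).
have q1k := rees_pp_exp pp nz.
have : F (zdeg q1) (rees_val p ^+ (k + c))@_q1 by rewrite -rees_valX; apply: reesP.
move: (_@__) => f Ff.
have HK := colon_ideal b (fil_ideal F (zdeg q1 + (zdeg m + zunit i))).
suff: [set f | F (zdeg q1 + (zdeg m + zunit i)) (f * b)] f by [].
apply: (Lgen _ _ _ Ff HK) => g u gL /= Iu.
have le_k : zle (zone *+ k) (zdeg q1 - g.1).
  move=> j; have := q1k j; have := gc g j gL; rewrite !zoneM !ffunE.
  by move: (g.1 j) (q1 j) => x y; lia.
move: Iu; rewrite -[zdeg q1 - g.1](subrK (zone *+ k)).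
apply: (multi_pow_ind _ _ (colon_ideal g.2 HK)); [exact: zle_subr_ge0|exact: zone_ge0|].
move=> u1 u2 Iu1 /Ib Fu2 /=.
have -> : zdeg q1 + (zdeg m + zunit i) =
    zdeg q1 - g.1 - zone *+ k + g.1 + (zdeg m + zunit i + zone *+ k).
  by apply/ffunP => j; rewrite !ffunE; ring.
have -> : u1 * u2 * g.2 * b = u1 * g.2 * (u2 * b) by ring.
by apply: fil_mul => //; apply: fil_mul; [apply: fil_pow | apply: FL].
Qed.

(** Climb to m through the degrees q <= m, one unit vector at a time.  The
    hypothesis in degree m descends to every such q because F is decreasing. *)
Lemma grade_saturated m : extended_rees_finite I F ->
  (forall i, grade_ge (assoc_pp F i) 1) -> saturated F (zdeg m).
Proof.
move=> Ffin grd b k Fb.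
suff H q : zle (zdeg q) (zdeg m) -> F (zdeg q) b by apply: H.
elim/mnm_ind: q => [_|q i IH qm]; first exact: fil_zdeg0.
rewrite zdegD zdegU.
have qq : zle (zdeg q) (zdeg (q + U_(i))%MM) by move=> j; rewrite !ffunE mnmDE; lia.
apply: (grade_step (k := k) Ffin (grd i)).
  by apply: IH => j; apply: le_trans (qq j) (qm j).
move=> u /Fb; apply: fil_le => j; rewrite -zdegU -zdegD ffunE [leRHS]ffunE.
by rewrite lerD2r.
Qed.

(** If no element of G_i(F)_++ were a nonzerodivisor, some z <> 0 would be killed
    by all the u t^e with u in I^e; comparing coefficients degree by degree,
    saturation forces z = 0.  The ideal is proper because the degree-0 part of
    G_i(F) is R / F(e_i). *)
Lemma saturated_grade (i : 'I_s) : noetherian (rees F) -> ~ F (zunit i) 1 ->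
  (forall m, saturated F (zdeg m)) -> grade_ge (assoc_pp F i) 1.
Proof.
move=> noethF F1 sat.
have [|x Jx xreg] := noetherian_nzd (assoc_noetherian noethF (i := i)) (assoc_pp_ideal F i).
  move=> z z0; apply: contrapT => nz; move/eqP: z0; apply.
  have [p pz] := assoc_pi_surj z; rewrite -pz; apply/assoc_pi_eq0 => m.
  rewrite -zdegU -zdegD; apply: (sat _ _ 1%N) => u; rewrite mulr1n => Iu.
  have Fu : F (zdeg mone) u by rewrite zdeg_mone1; apply: fil_pow.
  have : assoc_pi i (mono F mone u * p) = 0.
    rewrite assoc_pi_mul pz; apply: contrapT => /eqP nz0; apply: nz.
    exists (assoc_pi i (mono F mone u)) => //; exists (mono F mone u) => //.
    exact: rees_pp_mono.
  move=> /assoc_pi_eq0/(_ (mone + m)%MM).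
  rewrite rees_valM monoE // -scalerAl mcoeffZ [_ * rees_val p]mulrC.
  by rewrite mcoeffMX !zdegD zdegU zdeg_mone1 -addrA addrC.
exists [:: x]; split=> //; last first.
  by move=> y /=; rewrite inE => /eqP ->.
split=> [[|//] a _ /= /ideal_gen0 xa|].
  by rewrite (xreg a xa); case: (ideal_genP [set` [::] : seq (assoc_ring F i)]).
move=> gen1; apply: F1.
have [p pp /esym p1] : assoc_pp F i 1.
  apply: ideal_gen_sub gen1; first exact: assoc_pp_ideal.
  by move=> y /=; rewrite inE => /eqP ->.
have /assoc_pi_eq0/(_ 0%MM) : assoc_pi i (1 - p) = 0.
  by apply: (addIr (assoc_pi i p)); rewrite -assoc_pi_add subrK add0r -p1.
rewrite rees_valB mcoeffB mcoeff1 eqxx zdeg0 add0r.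
have [->|/pp/(_ i)] := eqVneq (rees_val p)@_0%MM 0; first by rewrite subr0.
by rewrite mnm0E.
Qed.

Lemma radical_multi_pow x : (forall i, radical (I i) x) ->
  radical (multi_pow I zone) x.
Proof.
move=> xI; rewrite /multi_pow; elim: (index_enum _) => [|i l IH].
  by rewrite big_nil; exists 0%N.
rewrite big_cons ffunE; apply: radical_mul => //; have [k Ik] := xI i.
by exists k; rewrite -[x ^+ k]mulr1; apply: ideal_mulP.
Qed.

End Grade.

Theorem proposition4p2 (R : comNzRingType) (m : set R) (d s : nat)
    (I : 'I_s -> set R) (F : filtration I) :
  cohen_macaulay_local m d -> (2 <= d)%N -> infinite_residue_field m ->
  (1 <= s)%N -> (forall i, m_primary m (I i)) -> admissible F ->
  (forall n : zvec s, zle 0%R n -> H1_rees_eq0 F n)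
  <-> (forall i : 'I_s, grade_ge (assoc_pp F i) 1).
Proof.
move=> [noethR _ _ [grd _]] d2 _ _ prim adm.
have [x [y [mx my xreg yreg]]] := grade_ge2P grd d2.
have HI i : is_ideal (I i) by case: (prim i) => -[].
have mI z : m z -> radical (multi_pow I zone) z.
  by move=> mz; apply: radical_multi_pow => i; case: (prim i) => _ ->.
split=> [H1 i|grade n n0].
  have mono_sat q : saturated F (zdeg q).
    by apply: H1_saturated xreg (mI x mx) _; apply: H1; apply: zdeg_ge0.
  apply: saturated_grade => //; first exact: rees_noetherian.
  by apply: fil_unit_proper => //; [case: adm | case: (prim i) => -[]].
have [xs Exs] := noethR _ (multi_powP I zone).
rewrite -(znatK n0); apply: (saturated_H1 Exs xreg yreg); [exact: mI..|].
by apply: grade_saturated => //; case: adm.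
Qed.
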